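(* Let $K\in\mathbb{R}$ and let $(X_i,\mathsf{d}_i,\mathfrak m_i)_{i\in\mathbb N}$ be a sequence of compact metric measure spaces each satisfying the $\mathrm{BCD}(K,\infty)$ condition, converging to $(X,\mathsf{d},\mathfrak m)$ in the measured Gromov–Hausdorff sense. Then $(X,\mathsf{d},\mathfrak m)$ satisfies the $\mathrm{BCD}(K,\infty)$ condition.
   Context: $\mathcal P(X)$: Borel probability measures, $W_2$ the quadratic Wasserstein distance. For $\Omega$ a probability measure on $\mathcal P(X)$, $\mathrm{Var}(\Omega)=\inf_\nu\int W_2^2(\mu,\nu)\,d\Omega(\mu)$, and a (Wasserstein) barycenter is a minimizer. $\mathrm{Ent}_{\mathfrak m}(\mu)=\int\rho\ln\rho\,d\mathfrak m$ if $\mu=\rho\mathfrak m$, else $+\infty$. $\mathrm{BCD}(K,\infty)$: for every probability measure $\Omega$ on $\mathcal P(X)$ with finite support and finite variance there exists a barycenter $\bar\mu$ of $\Omega$ with $\mathrm{Ent}_{\mathfrak m}(\bar\mu)\le\int\mathrm{Ent}_{\mathfrak m}(\mu)\,d\Omega(\mu)-\frac K2\mathrm{Var}(\Omega)$. A map $\varphi:(X_1,\mathsf d_1)\to(X_2,\mathsf d_2)$ is an $\epsilon$-approximation if $|\mathsf d_2(\varphi(x),\varphi(y))-\mathsf d_1(x,y)|\le\epsilon$ for all $x,y$ and every $x_2\in X_2$ is within $\epsilon$ of $\varphi(X_1)$. $(X_i,\mathsf d_i,\mathfrak m_i)\to(X,\mathsf d,\mathfrak m)$ in measured Gromov–Hausdorff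 sense if there are $\epsilon_i$-approximations $\varphi_i:X_i\to X$ with $\epsilon_i\downarrow0$ and $(\varphi_i)_\sharp\mathfrak m_i\to\mathfrak m$ weakly (against bounded continuous functions). *)

(* Defs.v *)
From HB Require Import structures.
From mathcomp Require Import all_boot all_order all_algebra.
From mathcomp Require Import all_classical all_reals all_analysis.
Set Implicit Arguments. Unset Strict Implicit. Unset Printing Implicit Defensive.
Import Order.TTheory GRing.Theory Num.Theory.
Local Open Scope classical_set_scope.
Local Open Scope ring_scope.

Section Defs.
Context {R : realType}.

Definition is_metric (T : Type) (dist : T -> T -> R) : Prop :=
  [/\ forall x y, dist x y = 0 <-> x = y,
      forall x y, dist x y = dist y x &
      forall x y z, dist x z <= dist x y + dist y z].

Definition dball (T : Type) (dist : T -> T -> R) (x : T) (r : R) : set T :=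
  [set y | dist x y < r].

Definition dopen (T : Type) (dist : T -> T -> R) (A : set T) : Prop :=
  forall x, A x -> exists2 r, 0 < r & dball dist x r `<=` A.

Definition dcompact (T : Type) (dist : T -> T -> R) : Prop :=
  forall (I : Type) (U : I -> set T), (forall i, dopen dist (U i)) ->
    [set: T] `<=` \bigcup_i U i ->
    exists (k : nat) (g : 'I_k -> I), [set: T] `<=` \bigcup_(j : 'I_k) U (g j).

Definition borel_of d (X : measurableType d) (dist : X -> X -> R) : Prop :=
  (@measurable d X) = <<s dopen dist >>.

Definition compact_mms d (X : measurableType d) (dist : X -> X -> R)
    (m : {measure set X -> \bar R}) : Prop :=
  [/\ is_metric dist, dcompact dist, borel_of dist & (m setT < +oo)%E].

Definition coupling d (X : measurableType d) (mu nu : probability X R)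
    (pi : probability (X * X)%type R) : Prop :=
  (forall A, measurable A -> pi (A `*` [set: X]) = mu A) /\
  (forall B, measurable B -> pi ([set: X] `*` B) = nu B).

Definition W2sq d (X : measurableType d) (dist : X -> X -> R)
    (mu nu : probability X R) : \bar R :=
  ereal_inf [set c | exists pi : probability (X * X)%type R,
     coupling mu nu pi /\ c = (\int[pi]_z ((dist z.1 z.2) ^+ 2)%:E)%E].

(** A finitely supported probability measure Omega on P(X) is given by
    finitely many measures mus j with weights lam j (lam >= 0, sum = 1):
    Omega = \sum_j lam j \delta_{mus j}. *)
Definition prob_weights (n : nat) (lam : 'I_n -> R) : Prop :=
  (forall j, 0 <= lam j) /\ \sum_(j < n) lam j = 1.

Definition wcost d (X : measurableType d) (dist : X -> X -> R) (n : nat)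
    (lam : 'I_n -> R) (mus : 'I_n -> probability X R) (nu : probability X R)
    : \bar R :=
  (\sum_(j < n) (lam j)%:E * W2sq dist (mus j) nu)%E.

Definition Var d (X : measurableType d) (dist : X -> X -> R) (n : nat)
    (lam : 'I_n -> R) (mus : 'I_n -> probability X R) : \bar R :=
  ereal_inf [set wcost dist lam mus nu | nu in [set: probability X R]].

Definition is_barycenter d (X : measurableType d) (dist : X -> X -> R)
    (n : nat) (lam : 'I_n -> R) (mus : 'I_n -> probability X R)
    (nu : probability X R) : Prop :=
  wcost dist lam mus nu = Var dist lam mus.

(** Relative entropy: Ent_m(mu) = \int rho ln rho dm if mu = rho m, +oo
    otherwise (densities are unique m-a.e., so the infimum over all
    densities is that common value; the infimum of the empty set is +oo). *)
Definition Ent d (X : measurableType d) (m : {measure set X -> \bar R})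
    (mu : probability X R) : \bar R :=
  ereal_inf [set e | exists rho : X -> R,
    [/\ measurable_fun [set: X] rho, (forall x, 0 <= rho x),
        (forall A, measurable A -> mu A = (\int[m]_(x in A) (rho x)%:E)%E) &
        e = (\int[m]_x (rho x * ln (rho x))%:E)%E]].

Definition BCD d (X : measurableType d) (dist : X -> X -> R)
    (m : {measure set X -> \bar R}) (K : R) : Prop :=
  forall (n : nat) (lam : 'I_n -> R) (mus : 'I_n -> probability X R),
    prob_weights lam -> (Var dist lam mus < +oo)%E ->
    exists nu : probability X R, is_barycenter dist lam mus nu /\
      (Ent m nu <= \sum_(j < n) (lam j)%:E * Ent m (mus j)
                   - (K / 2)%:E * Var dist lam mus)%E.

Definition eps_approx (T1 T2 : Type) (d1 : T1 -> T1 -> R) (d2 : T2 -> T2 -> R)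
    (phi : T1 -> T2) (eps : R) : Prop :=
  (forall x y, `| d2 (phi x) (phi y) - d1 x y | <= eps) /\
  (forall x2, exists x1, d2 x2 (phi x1) <= eps).

Definition bounded_continuous (T : Type) (dist : T -> T -> R) (f : T -> R) : Prop :=
  (exists M, forall x, `| f x | <= M) /\
  (forall x (e : R), 0 < e -> exists2 delta, 0 < delta &
     forall y, dist x y < delta -> `| f x - f y | < e).

(** measured Gromov-Hausdorff convergence; the integral of f against the
    push-forward (phi i)_# (ms i) is written as \int f (phi i x) d(ms i)(x). *)
Definition mGH_converges (dXs : nat -> measure_display)
    (Xs : forall i, measurableType (dXs i))
    (dists : forall i, Xs i -> Xs i -> R)
    (ms : forall i, {measure set Xs i -> \bar R})
    d (X : measurableType d) (dist : X -> X -> R)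
    (m : {measure set X -> \bar R}) : Prop :=
  exists (eps : nat -> R) (phis : forall i, Xs i -> X),
    [/\ (forall i, 0 <= eps i) /\ (forall i, eps i.+1 <= eps i),
        eps @ \oo --> 0,
        (forall i, eps_approx (dists i) dist (phis i) (eps i)),
        (forall i, measurable_fun [set: Xs i] (phis i)) &
        (forall f : X -> R, bounded_continuous dist f ->
          (fun i => \int[ms i]_x (f (phis i x))%:E)%E @ \oo -->
            (\int[m]_x (f x)%:E)%E)].

End Defs.

(* Main.v *)
Require Import Defs.
From HB Require Import structures.
From mathcomp Require Import all_boot all_order all_algebra.
From mathcomp Require Import all_classical all_reals all_analysis.
From mathcomp Require Import measurable_realfun ring lra.
Set Implicit Arguments. Unset Strict Implicit. Unset Printing Implicit Defensive.
Import Order.TTheory GRing.Theory Num.Theory.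
Import numFieldNormedType.Exports.
Local Open Scope classical_set_scope.
Local Open Scope ring_scope.

(** Approximate the [mu_j] on [X_i] by [mu_j^i], with density
    [sum_l (c_l / b_l) h_l (phi_i x)] with respect to [m_i], where [(h_l)] is a
    Lipschitz partition of unity of small diameter, [c_l] is the integral of [h_l]
    against [mu_j] and [b_l] that of [h_l o phi_i] against [m_i]. By Jensen the
    entropies of the [mu_j^i] are asymptotically at most those of the [mu_j]; and every
    coupling on [X] of [mu_j] with some [nu] is transported cell by cell to a coupling
    on [X_i] of nearly the same cost, so the variances on [X_i] are asymptotically at
    most the variance on [X], with no gluing of couplings. BCD on [X_i] yields
    barycenters; push them, with near-optimal couplings, to [X]. Weak compactness on
    [X * X] gives limit couplings, which show that the limit measure is a barycenter
    and that the variances converge. The entropy bound passes to the limit through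
    [Ent_m(nu) = sup_f (int f dnu - int exp (f - 1) dm)], [f] Lipschitz.

    Limits are taken along a fixed ultrafilter, which replaces the extraction of
    subsequences. Weak compactness is proved without the Riesz representation theorem:
    the limiting masses of the cells of nested partitions are realized by nested
    subintervals of [0, 1), and the limit measure is the image of Lebesgue measure under
    the map sending a point to the limit of the cells attached to it. *)

(** * Bounded measurable functions and densities *)

(** The maps [phi_i] are only measurable, so a measure on [X] cannot be pulled back to [X_i];
    functions can. Hence a measure is first reduced to its finitely many masses against the [h_l],
    and these are realized again on [X_i] through [h_l o phi_i]. The masses of [h_l o phi_i]
    converge only for a fixed partition, so the mesh is chosen first and the index [i] afterwards.
    The reference measure varies with [i]. In the dual formula both terms are integrals of fixed
    Lipschitz functions, so the passage to the limit is the same for [nu] and for [m]. Lipschitz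
    tests suffice because they are dense in L^1 of every finite Borel measure on [X]. As [K] may
    have either sign, a one-sided estimate of the variances would not do: they have to converge. If
    some measure of positive weight has infinite entropy, the entropy bound is trivial and only the
    existence of a barycenter of [X] is left, which the same compactness argument gives on [X]
    alone. *)

Section bounded_measurable.
Context d (T : measurableType d) (R : realType).
Implicit Types f g : T -> R.

(** On a finite measure this class is integrable and stable under all operations used below, so
    real-valued integrals can be manipulated without integrability side conditions. *)
Definition bmeas f := measurable_fun [set: T] f /\ exists M, forall x, `|f x| <= M.

Lemma bmeas_cst (c : R) : bmeas (fun=> c).
Proof. by split => //; exists `|c|. Qed.

Lemma bmeasD f g : bmeas f -> bmeas g -> bmeas (fun x => f x + g x).
Proof.
move=> [mf [M fM]] [mg [N gN]]; split; first exact: measurable_funD.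
by exists (M + N) => x; rewrite (le_trans (ler_normD _ _))// lerD.
Qed.

Lemma bmeasM f g : bmeas f -> bmeas g -> bmeas (fun x => f x * g x).
Proof.
move=> [mf [M fM]] [mg [N gN]]; split; first exact: measurable_funM.
by exists (M * N) => x; rewrite normrM ler_pM.
Qed.

Lemma bmeasZ c f : bmeas f -> bmeas (fun x => c * f x).
Proof. by apply: bmeasM; exact: bmeas_cst. Qed.

Lemma bmeasB f g : bmeas f -> bmeas g -> bmeas (fun x => f x - g x).
Proof.
move=> bf bg; under eq_fun do rewrite -mulN1r.
by apply: bmeasD => //; exact: bmeasZ.
Qed.

Lemma bmeas_norm f : bmeas f -> bmeas (fun x => `|f x|).
Proof.
move=> [mf [M fM]]; split; first exact: measurableT_comp.
by exists M => x; rewrite normr_id.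
Qed.

Lemma bmeas_expR f : bmeas f -> bmeas (fun x => expR (f x)).
Proof.
move=> [mf [M fM]]; split; first exact: measurableT_comp.
exists (expR M) => x; rewrite ger0_norm ?expR_ge0// ler_expR.
by rewrite (le_trans _ (fM x))// ler_norm.
Qed.

Lemma bmeas_sum (I : Type) (s : seq I) (h : I -> T -> R) :
  (forall i, bmeas (h i)) -> bmeas (fun x => \sum_(i <- s) h i x).
Proof.
move=> bh; elim: s => [|i s IHs].
  by under eq_fun do rewrite big_nil; exact: bmeas_cst.
by under eq_fun do rewrite big_cons; exact: bmeasD.
Qed.

Lemma bmeas_indic (A : set T) : measurable A -> bmeas (\1_A : T -> R).
Proof.
move=> mA; split; first exact: measurable_indic.
by exists 1 => x; rewrite indicE ger0_norm//; case: (x \in A).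
Qed.

Context (m : {measure set T -> \bar R}).
Hypothesis mfin : (m setT < +oo)%E.

Lemma bmeas_integrable f : bmeas f -> m.-integrable setT (EFin \o f).
Proof.
move=> [mf [M fM]]; apply: measurable_bounded_integrable => //.
by exists M; split; [exact: num_real|move=> y My x _; apply: le_trans (ltW My)].
Qed.

Lemma bint_EFin f : bmeas f -> (\int[m]_x (f x)%:E)%E = (\int[m]_x f x)%:E.
Proof.
move=> bf; rewrite /Rintegral fineK//; apply: integrable_fin_num => //.
exact: bmeas_integrable.
Qed.

Lemma bintD f g : bmeas f -> bmeas g ->
  \int[m]_x (f x + g x) = \int[m]_x f x + \int[m]_x g x.
Proof. by move=> bf bg; rewrite RintegralD//; exact: bmeas_integrable. Qed.

Lemma bintB f g : bmeas f -> bmeas g ->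
  \int[m]_x (f x - g x) = \int[m]_x f x - \int[m]_x g x.
Proof. by move=> bf bg; rewrite RintegralB//; exact: bmeas_integrable. Qed.

Lemma bintZ c f : bmeas f -> \int[m]_x (c * f x) = c * \int[m]_x f x.
Proof. by move=> bf; rewrite RintegralZl//; exact: bmeas_integrable. Qed.

Lemma bint_cst c : \int[m]_x c = c * fine (m setT).
Proof. exact: Rintegral_cst. Qed.

Lemma le_bint f g : bmeas f -> bmeas g -> (forall x, f x <= g x) ->
  \int[m]_x f x <= \int[m]_x g x.
Proof. by move=> bf bg fg; apply: le_Rintegral => //; exact: bmeas_integrable. Qed.

Lemma bint_ge0 f : (forall x, 0 <= f x) -> 0 <= \int[m]_x f x.
Proof. by move=> f0; exact: Rintegral_ge0. Qed.

Lemma bint_sum (I : Type) (s : seq I) (h : I -> T -> R) :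
  (forall i, bmeas (h i)) ->
  \int[m]_x (\sum_(i <- s) h i x) = \sum_(i <- s) \int[m]_x h i x.
Proof.
move=> bh; elim: s => [|i s IHs].
  rewrite big_nil; under eq_Rintegral do rewrite big_nil.
  by rewrite bint_cst mul0r.
rewrite big_cons -IHs -bintD//; last exact: bmeas_sum.
by apply: eq_Rintegral => x _; rewrite big_cons.
Qed.

Lemma bint_indic (A : set T) : measurable A -> \int[m]_x (\1_A x) = fine (m A).
Proof. by move=> mA; rewrite /Rintegral integral_indic// setIT. Qed.

Lemma dist_bint f g e : bmeas f -> bmeas g -> (forall x, `|f x - g x| <= e) ->
  `|\int[m]_x f x - \int[m]_x g x| <= e * fine (m setT).
Proof.
move=> bf bg fg; rewrite -bintB// -bint_cst.
apply: le_trans (le_bint _ _ fg); last 2 first.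
- by apply: bmeas_norm; exact: bmeasB.
- exact: bmeas_cst.
by apply: le_normr_Rintegral => //; apply: bmeas_integrable; exact: bmeasB.
Qed.

End bounded_measurable.

Section density.
Context d (T : measurableType d) (R : realType).
Variables (m : {measure set T -> \bar R}) (mu : {measure set T -> \bar R}).
Variable rho : T -> R.
Hypothesis mrho : measurable_fun setT rho.
Hypothesis rho0 : forall x, 0 <= rho x.
Hypothesis murho : forall A, measurable A -> mu A = (\int[m]_(x in A) (rho x)%:E)%E.

Import HBNNSimple.

Lemma ge0_integral_density (f : T -> \bar R) :
  measurable_fun setT f -> (forall x, 0 <= f x)%E ->
  (\int[mu]_x f x = \int[m]_x (f x * (rho x)%:E))%E.
Proof.
move=> mf f0; pose h := nnsfun_approx measurableT mf.
have fE x : f x = lim ((EFin \o h n) x @[n --> \oo]).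
  by apply/esym/cvg_lim => //; exact: cvg_nnsfun_approx.
have -> : (\int[mu]_x f x = lim (\int[mu]_x (EFin \o h n) x @[n --> \oo]))%E.
  under eq_integral => x _ do rewrite fE.
  apply: monotone_convergence => //.
  - by move=> n; apply/measurable_EFinP; exact/measurable_funP.
  - by move=> n x _; rewrite /= lee_fin.
  - by move=> x _ a b ab; rewrite lee_fin; exact/lefP/nd_nnsfun_approx.
have -> : (\int[m]_x (f x * (rho x)%:E) =
    lim (\int[m]_x ((h n x)%:E * (rho x)%:E) @[n --> \oo]))%E.
  have fg x : (f x * (rho x)%:E = lim (((h n x)%:E * (rho x)%:E) @[n --> \oo]))%E.
    by apply/esym/cvg_lim => //; apply: cvgeZr => //; exact: cvg_nnsfun_approx.
  under eq_integral => x _ do rewrite fg.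
  apply: monotone_convergence => //.
  - move=> n; apply: emeasurable_funM; apply/measurable_EFinP => //.
  - by move=> n x _ /=; rewrite mule_ge0 ?lee_fin.
  - by move=> x _ a b ab/=; rewrite lee_wpmul2r ?lee_fin//; exact/lefP/nd_nnsfun_approx.
(* Both sides are now monotone limits along the same simple functions, so it remains to compare them
   for a single [h n]. *)
congr (limn _); apply/funext => n.
transitivity (\int[mu]_x
   (\sum_(y \in range (h n)) (y * \1_(h n @^-1` [set y]) x)%:E))%E.
  by apply: eq_integral => t tE; rewrite /= fimfunE -fsumEFin.
have mi r : measurable_fun setT (fun x => (r * \1_(h n @^-1` [set r]) x)%:E).
  by apply/measurable_EFinP; apply: measurable_funM.
rewrite ge0_integral_fsum//; last by move=> k y Ey; exact: nnfun_muleindic_ge0.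
transitivity (\int[m]_x (\sum_(y \in range (h n))
    (y * \1_(h n @^-1` [set y]) x)%:E * (rho x)%:E))%E; last first.
  apply: eq_integral => x _.
  rewrite -ge0_mule_fsuml => [|y]; last exact: nnfun_muleindic_ge0.
  by rewrite fsumEFin // -(fimfunE _ x).
rewrite ge0_integral_fsum//; last 2 first.
  - by move=> y; apply: emeasurable_funM => //; exact/measurable_EFinP.
  - by move=> k y Ey; apply: mule_ge0; [exact: nnfun_muleindic_ge0|rewrite lee_fin].
apply: eq_fsbigr => r rhn.
under [LHS]eq_integral do rewrite EFinM.
rewrite integralZl_indic_nnsfun// integral_indic// setIT.
under [RHS]eq_integral do rewrite EFinM -muleA.
have r0 : 0 <= r by move: rhn; rewrite inE => -[t _ <-].
rewrite ge0_integralZl//; last 2 first.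
- by apply: emeasurable_funM; exact/measurable_EFinP.
- by move=> t _; rewrite mule_ge0 ?lee_fin.
congr (_ * _)%E; rewrite murho// integral_mkcond/=.
by apply: eq_integral => x _; rewrite epatch_indic/= muleC.
Qed.

End density.

(* A convertible copy of [m], to which the probability structure can be attached. *)
Definition measure_fun d (T : measurableType d) (R : realType)
  (m : {measure set T -> \bar R}) & m setT = 1%E : set T -> \bar R := m.

Section measure_fun.
Context d (T : measurableType d) (R : realType).
Variables (m : {measure set T -> \bar R}) (m1 : m setT = 1%E).

HB.instance Definition _ := isMeasure.Build d T R (measure_fun m1)
  (measure0 m) (measure_ge0 m) (@measure_semi_sigma_additive _ _ _ m).
HB.instance Definition _ := Measure_isProbability.Build d T R (measure_fun m1) m1.

End measure_fun.

(** * Constructions of probability measures *)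

Section constructions.
Context d (T : measurableType d) (R : realType).

Lemma probability_of_measure (m : {measure set T -> \bar R}) : m setT = 1%E ->
  exists P : probability T R, (forall A, P A = m A) /\
    (forall f : T -> \bar R, (\int[P]_x f x = \int[m]_x f x)%E).
Proof.
by move=> m1; exists (measure_fun m1); split.
Qed.

Lemma mixture_measure (I : Type) (s : seq I) (q : I -> R)
    (P : I -> {measure set T -> \bar R}) : (forall i, 0 <= q i) ->
  exists m : {measure set T -> \bar R},
    (forall A, m A = (\sum_(i <- s) (q i)%:E * P i A)%E) /\
    (forall f : T -> \bar R, measurable_fun setT f -> (forall x, 0 <= f x)%E ->
      (\int[m]_x f x = \sum_(i <- s) (q i)%:E * \int[P i]_x f x)%E).
Proof.
move=> q0; elim: s => [|i s [m [mE mI]]].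
  exists mzero; split=> [A|f mf f0]; first by rewrite big_nil.
  by rewrite big_nil integral_measure_zero.
exists (measure_add (mscale (NngNum (q0 i)) (P i)) m); split=> [A|f mf f0].
  by rewrite big_cons -mE; exact: measure_addE.
by rewrite big_cons -mI// ge0_integral_measure_add// ge0_integral_mscale.
Qed.

Lemma mixture_probability (I : finType) (q : I -> R)
    (P : I -> probability T R) : (forall i, 0 <= q i) -> \sum_i q i = 1 ->
  exists Q : probability T R,
    (forall A, Q A = (\sum_i (q i)%:E * P i A)%E) /\
    (forall f : T -> \bar R, measurable_fun setT f -> (forall x, 0 <= f x)%E ->
      (\int[Q]_x f x = \sum_i (q i)%:E * \int[P i]_x f x)%E).
Proof.
move=> q0 q1; have [m [mE mI]] := mixture_measure (index_enum I) P q0.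
have [|Q [QE QI]] := @probability_of_measure m.
  rewrite mE -q1 -sumEFin; apply: eq_bigr => i _.
  by rewrite -[RHS]mule1; congr (_ * _)%E; exact: probability_setT.
by exists Q; split=> [A|f mf f0]; rewrite ?QE ?mE// QI mI.
Qed.

Lemma density_probability (m : {measure set T -> \bar R}) (rho : T -> R) :
  measurable_fun setT rho -> (forall x, 0 <= rho x) ->
  (\int[m]_x (rho x)%:E = 1)%E ->
  exists P : probability T R,
    forall A, measurable A -> P A = (\int[m]_(x in A) (rho x)%:E)%E.
Proof.
move=> mrho rho0 rho1; pose mu A := (\int[m]_(x in A) (rho x)%:E)%E.
have mu0 : mu set0 = 0%E by rewrite /mu integral_set0.
have mu_ge0 A : (0 <= mu A)%E by apply: integral_ge0 => x _; rewrite lee_fin.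
have mu_sa : semi_sigma_additive mu.
  by apply: semi_sigma_additive_nng_induced => //; exact/measurable_EFinP.
pose M : {measure set T -> \bar R} := HB.pack_for {measure set T -> \bar R} mu
  (isMeasure.Build d T R mu mu0 mu_ge0 mu_sa).
have [//|P [PE _]] := @probability_of_measure M.
by exists P => A _; rewrite PE.
Qed.

Lemma push_probability d' (T' : measurableType d') (P : probability T R) (f : T -> T') :
  measurable_fun setT f ->
  exists Q : probability T' R, (forall A, Q A = P (f @^-1` A)) /\
   (forall g : T' -> \bar R, measurable_fun setT g -> (forall x, 0 <= g x)%E ->
      (\int[Q]_x g x = \int[P]_x g (f x))%E).
Proof.
move=> mf.
pose X : {mfun T >-> T'} := HB.pack_for {mfun T >-> T'} f
  (isMeasurableFun.Build _ _ _ _ _ mf).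
exists (distribution P X); split=> // g mg g0.
by rewrite ge0_integral_pushforward.
Qed.

End constructions.

(** Only the smaller function is assumed integrable: the larger one will be [rho ln rho], whose
    integral may be infinite. *)
Lemma le_integralr d (T : measurableType d) (R : realType)
    (m : {measure set T -> \bar R}) (f g : T -> \bar R) :
  m.-integrable setT f -> measurable_fun setT g -> (forall x, f x <= g x)%E ->
  (\int[m]_x f x <= \int[m]_x g x)%E.
Proof.
move=> intf mg fg; have mf := measurable_int _ intf.
rewrite (integralE m setT f) (integralE m setT g); apply: leeB.
- apply: ge0_le_integral => //; try exact: measurable_funepos.
  by move=> x _; apply: (@funepos_le _ _ setT) => //; rewrite inE.
- apply: ge0_le_integral => //; try exact: measurable_funeneg.
  by move=> x _; apply: (@funeneg_le _ _ setT) => //; rewrite inE.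
Qed.

(** * Lower bound of the entropy by its dual *)

Lemma expR_tangent (R : realType) (a b : R) : expR a * (1 + b - a) <= expR b.
Proof.
have := expR_ge1Dx (b - a); rewrite -(ler_pM2l (expR_gt0 a)) -expRD addrA.
by rewrite (addrC a) subrK -addrA.
Qed.

(* Young's inequality for the conjugate pair [t ln t] and [exp (a - 1)]. *)
Lemma xlnx_dual (R : realType) (t a : R) : 0 <= t -> a * t <= t * ln t + expR (a - 1).
Proof.
rewrite le_eqVlt => /predU1P[<-|t0]; first by rewrite mulr0 mul0r add0r expR_ge0.
have := expR_tangent (ln t) (a - 1); rewrite lnK ?posrE//.
lra.
Qed.

Section Ent_dual.
Context d (T : measurableType d) (R : realType) (m : {measure set T -> \bar R}).
Hypothesis mfin : (m setT < +oo)%E.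
Variable mu : probability T R.

Lemma probability_lty : (mu setT < +oo)%E.
Proof. by rewrite probability_setT ltry. Qed.

Section rho.
Variable rho : T -> R.
Hypothesis mrho : measurable_fun setT rho.
Hypothesis rho0 : forall x, 0 <= rho x.
Hypothesis murho : forall A, measurable A -> mu A = (\int[m]_(x in A) (rho x)%:E)%E.

Lemma density_integrable : m.-integrable setT (EFin \o rho).
Proof.
apply/integrableP; split; first exact/measurable_EFinP.
under eq_integral do rewrite gee0_abs ?lee_fin//.
by rewrite -murho// probability_lty.
Qed.

Lemma bmeas_density_integrable f : bmeas f ->
  m.-integrable setT (fun x => (f x * rho x)%:E).
Proof.
move=> [mf [M fM]]; under eq_fun do rewrite EFinM.
apply: (@integrableMr _ _ _ m setT measurableT f (EFin \o rho)) => //.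
  by exists M; split; [exact: num_real|move=> y My x _; apply: le_trans (ltW My)].
exact: density_integrable.
Qed.

Lemma bint_density f : bmeas f -> \int[mu]_x f x = \int[m]_x (f x * rho x).
Proof.
move=> bf; have [mf [M fM]] := bf.
(* [ge0_integral_density] needs a nonnegative integrand, so [f] is shifted by its bound [M], and the
   constant is cancelled at the end. *)
have bM : bmeas (fun _ : T => M) by exact: bmeas_cst.
have bfM : bmeas (fun x => f x + M) by exact: bmeasD.
have fM0 x : 0 <= f x + M by have := fM x; rewrite ler_norml; lra.
have M1 : \int[m]_x (M * rho x) = M.
  rewrite RintegralZl//; last exact: density_integrable.
  by rewrite /Rintegral -murho// probability_setT mulr1.
apply: (@addIr _ M); rewrite -[in RHS]M1 -RintegralD//; last 2 first.
- exact: bmeas_density_integrable.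
- exact: bmeas_density_integrable.
rewrite -[in LHS](mulr1 M) -[in LHS](_ : fine (mu setT) = 1); last first.
  by rewrite probability_setT.
rewrite -bint_cst -bintD//; last exact: probability_lty.
rewrite /Rintegral (ge0_integral_density mrho rho0 murho)//.
- by congr fine; apply: eq_integral => x _; rewrite -EFinM mulrDl.
- by apply/measurable_EFinP; case: bfM.
Qed.

End rho.

(** Young's inequality [xlnx_dual] is integrated pointwise against each admissible density; if there
    is none, the entropy is an infimum over the empty set. *)
Lemma Ent_dual f : bmeas f ->
  ((\int[mu]_x f x - \int[m]_x expR (f x - 1))%:E <= Ent m mu)%E.
Proof.
move=> bf; apply: le_ereal_inf_tmp => _ [rho [mrho rho0 murho ->]].
have be : bmeas (fun x => expR (f x - 1)).
  by apply: bmeas_expR; apply: bmeasB => //; exact: bmeas_cst.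
have ifr := bmeas_density_integrable mrho rho0 murho bf.
rewrite (bint_density mrho rho0 murho bf) -RintegralB//; last exact: bmeas_integrable.
have iB : m.-integrable setT (fun x => (f x * rho x - expR (f x - 1))%:E).
  under eq_fun do rewrite EFinB.
  by apply: integrableB => //; exact: bmeas_integrable.
rewrite /Rintegral fineK; last exact: integrable_fin_num.
apply: le_integralr => //.
  apply/measurable_EFinP; apply: measurable_funM => //.
  exact: measurableT_comp.
by move=> x; rewrite lee_fin lerBlDr; exact: xlnx_dual.
Qed.

End Ent_dual.

(** * Weak compactness *)

(* Words are stored with the most recent digit first. The interval of the word [w] is
   [cell_start w, cell_start w + p w), and [digits k t] is the word of length [k] whose
   interval contains [t]. *)
Section coin_tossing.
Context (R : realType) (p : seq bool -> R).
Hypothesis p_nil : p [::] = 1.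
Hypothesis p_ge0 : forall w, 0 <= p w.
Hypothesis p_split : forall w, p w = p (false :: w) + p (true :: w).

Fixpoint cell_start (w : seq bool) : R :=
  if w is b :: v then cell_start v + (if b then p (false :: v) else 0) else 0.

Fixpoint digits (k : nat) (t : R) : seq bool :=
  if k is k'.+1 then
    (cell_start (digits k' t) + p (false :: digits k' t) <= t) :: digits k' t
  else [::].

Lemma size_digits k t : size (digits k t) = k.
Proof. by elim: k => //= k ->. Qed.

Lemma digitsP w t : 0 <= t < 1 ->
  (digits (size w) t == w) = (cell_start w <= t < cell_start w + p w).
Proof.
move=> t01; elim: w => [|b v IHv] /=; first by rewrite p_nil add0r t01.
rewrite eqseq_cons; case: (eqVneq (digits (size v) t) v) IHv => [->|_] IHv.
  move/esym/andP : IHv => [sv vs]; rewrite andbT.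
  have := p_split v; case: b => /=.
    by move=> pv; rewrite eqb_id -addrA -pv vs andbT.
  by rewrite eqbF_neg -ltNge addr0 sv.
(* The interval of [b :: v] lies inside that of [v], which does not contain [t]. *)
rewrite andbF; apply/esym/negbTE; apply: contra_eqN (esym IHv) => tb.
apply/negPn; move: tb (p_split v) (p_ge0 (false :: v)) (p_ge0 (true :: v)).
case: b => /= /andP[]; lra.
Qed.

Lemma cell_sub01 w t : cell_start w <= t < cell_start w + p w -> 0 <= t < 1.
Proof.
elim: w t => [|b v IHv] t /=; first by rewrite p_nil add0r.
move=> /andP[tb bt]; apply: IHv; move: tb bt.
move: (p_split v) (p_ge0 (false :: v)) (p_ge0 (true :: v)).
by case: b => /=; lra.
Qed.

(** Positivity of [p (W k t)] holds at every [t], not just almost everywhere; it later guarantees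
    that the cell named by [W k t] is inhabited. *)
Lemma coin_space : exists (P : probability (measurableTypeR R) R)
    (W : nat -> measurableTypeR R -> seq bool),
  [/\ forall k t, size (W k t) = k,
      forall k t, exists b, W k.+1 t = b :: W k t,
      forall w, measurable [set t | W (size w) t = w],
      forall w, P [set t | W (size w) t = w] = (p w)%:E &
      forall k t, 0 < p (W k t)].
Proof.
have mI : measurable (`[0, 1[%classic : set (measurableTypeR R)).
  exact: measurable_itv.
have [|P [PE _]] := @probability_of_measure _ (measurableTypeR R) R
    (mrestr lebesgue_measure mI).
  by rewrite /= /mrestr setTI lebesgue_measure_itv /= lte_fin ltr01 sube0.
(* [clip] keeps the digits off [0, 1) inside cells of positive mass. *)
pose clip (t : R) := if 0 <= t < 1 then t else 0.
have clip01 t : 0 <= clip t < 1 by rewrite /clip; case: ifPn => // _; rewrite lexx ltr01.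
have setE w : [set t | digits (size w) (clip t) = w] `&` `[0, 1[ =
    `[cell_start w, cell_start w + p w[%classic.
  apply/seteqP; split=> t /=; rewrite !in_itv /=.
    by move=> [/eqP + t01]; rewrite /clip t01 digitsP.
  move=> tw; have t01 := cell_sub01 tw; split=> //.
  by apply/eqP; rewrite /clip t01 digitsP.
exists P, (fun k t => digits k (clip t)); split.
- by move=> k t; exact: size_digits.
- by move=> k t; eexists; reflexivity.
- move=> w.
  rewrite -[X in measurable X](setIT) -(setUv `[0, 1[%classic) setIUr setE.
  apply: measurableU; first exact: measurable_itv.
  (* Outside [0, 1) [clip] is constantly 0, so this part of the set is the whole complement or
     empty, according to the digits of 0. *)
  have [w0|w0] := eqVneq (digits (size w) 0) w.
    rewrite (_ : _ `&` _ = ~` `[0, 1[%classic); first exact: measurableC.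
    apply/seteqP; split=> t /=; first by case.
    by rewrite in_itv /clip => t01; split=> //; rewrite ifN//; exact/negP.
  rewrite (_ : _ `&` _ = set0); first exact: measurable0.
  apply/seteqP; split=> t //= []; rewrite in_itv /clip => + t01.
  by rewrite ifN; [exact/eqP|exact/negP].
- move=> w; rewrite PE /= /mrestr setE lebesgue_measure_itv /= lte_fin ltrDl.
  case: ltrP => [pw|]; first by rewrite -EFinD addrAC subrr add0r.
  by move=> pw; congr EFin; apply/eqP; rewrite eq_le pw p_ge0.
- move=> k t; have := digitsP (digits k (clip t)) (clip01 t).
  rewrite size_digits eqxx => /esym/andP[a b].
  by have := le_lt_trans a b; rewrite ltrDl.
Qed.

End coin_tossing.

(** Compactness of the segment gives a cluster point; it is a limit because an ultrafilter contains
    each set or its complement. *)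
Lemma ultra_cvg_bounded (R : realType) (I : Type) (U : set_system I) (u : I -> R) (M : R) :
  UltraFilter U -> (forall n, `|u n| <= M) ->
  exists l : R, (u n @[n --> U] --> l).
Proof.
move=> UU uM.
have uI : (u @ U) `[- M, M]%classic.
  by apply: (@filterE _ U) => n; rewrite /= in_itv /= -ler_norml.
have [p [_ clp]] := @segment_compact R (- M) M (u @ U) _ uI.
exists p => N Np.
have [//|UN] := in_ultra_setVsetC (u @^-1` N) UU.
by have [x [Nx Nx']] := clp (~` N) N UN Np.
Qed.

Lemma cvg_sumR (R : realType) (I J : Type) (U : set_system I) (s : seq J)
    (u : J -> I -> R) (l : J -> R) : Filter U ->
  (forall j, u j n @[n --> U] --> l j) ->
  (\sum_(j <- s) u j n) @[n --> U] --> \sum_(j <- s) l j.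
Proof.
move=> FU ul; elim: s => [|j s IHs].
  by under eq_fun do rewrite big_nil; rewrite big_nil; exact: cvg_cst.
by under eq_fun do rewrite big_cons; rewrite big_cons; exact: cvgD.
Qed.

(** Passes from nonnegative to bounded integrands by adding a constant, which both probabilities
    integrate to itself. *)
Lemma bint_transfer d d' (T : measurableType d) (T' : measurableType d') (R : realType)
    (P : probability T R) (Q : probability T' R) (f : T -> T') :
  measurable_fun setT f ->
  (forall g : T' -> \bar R, measurable_fun setT g -> (forall x, 0 <= g x)%E ->
      (\int[Q]_x g x = \int[P]_x g (f x))%E) ->
  forall g : T' -> R, bmeas g -> \int[Q]_x g x = \int[P]_x g (f x).
Proof.
move=> mf PQ g bg; have [mg [M gM]] := bg.
have bgf : bmeas (fun x => g (f x)).
  by split; [exact: measurableT_comp mg mf|exists M].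
have gM0 x : 0 <= g x + M by have := gM x; rewrite ler_norml; lra.
have bM e (S : measurableType e) : bmeas (fun _ : S => M) by exact: bmeas_cst.
have cM e (S : measurableType e) (m : probability S R) : \int[m]_x M = M.
  by rewrite bint_cst [X in fine X](@probability_setT _ _ _ m) mulr1.
apply: (@addIr _ M); rewrite -[X in _ + X = _](cM _ _ Q) -[X in _ = _ + X](cM _ _ P).
rewrite -!bintD//; [|exact: probability_lty..].
rewrite /Rintegral PQ//; apply/measurable_EFinP.
by apply: measurable_funD.
Qed.

(** * Functions of finite words, and itineraries of points *)

Section words.
Context d (S : measurableType d) (R : realType) (c : S -> seq bool) (k : nat).
Hypothesis size_c : forall s, size (c s) = k.
Hypothesis mc : forall w, measurable [set s | c s = w].

(** Words of length [k] are finite in number, so an arbitrary predicate on them selects a finite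
    union of measurable cells. *)
Lemma word_measurable (P : set (seq bool)) : measurable [set s | P (c s)].
Proof.
rewrite (_ : [set s | _] = \bigcup_(w in [set: k.-tuple bool])
    if `[< P w >] then [set s | c s = w] else set0).
  apply: fin_bigcup_measurable => // w _.
  by case: ifP => _; [exact: mc|exact: measurable0].
apply/seteqP; split=> s /=.
  move=> Ps; have sk : size (c s) == k by rewrite size_c.
  by exists (Tuple sk) => //=; rewrite asboolT.
by move=> [w _]; case: asboolP => // Pw /= ->.
Qed.

Lemma word_fun_measurable (G : seq bool -> R) : measurable_fun setT (fun s => G (c s)).
Proof.
by move=> _ A mA; rewrite setTI; exact: (word_measurable (fun w => A (G w))).
Qed.

Lemma word_funE (G : seq bool -> R) s :
  G (c s) = \sum_(w : k.-tuple bool) G w * \1_[set s | c s = w] s.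
Proof.
have sk : size (c s) == k by rewrite size_c.
rewrite (bigD1 (Tuple sk)) //= indicE mem_set//= mulr1 big1 ?addr0// => w wc.
rewrite indicE memNset ?mulr0//= => cw; move/eqP : wc; apply.
exact/val_inj.
Qed.

Lemma word_fun_bmeas (G : seq bool -> R) : bmeas (fun s => G (c s)).
Proof.
under eq_fun do rewrite word_funE.
by apply: bmeas_sum => w; apply: bmeasZ; exact: bmeas_indic.
Qed.

Lemma word_integral (P : probability S R) (G : seq bool -> R) :
  \int[P]_s G (c s) = \sum_(w : k.-tuple bool) G w * fine (P [set s | c s = w]).
Proof.
under eq_Rintegral do rewrite word_funE.
have Pfin := probability_lty P.
have bi w : bmeas (\1_[set s | c s = w] : S -> R) by exact: bmeas_indic.
rewrite bint_sum//; last by move=> w; exact: bmeasZ.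
by apply: eq_bigr => w _; rewrite bintZ// bint_indic.
Qed.

End words.

Lemma cvg_uniqR (R : realType) (I : Type) (U : set_system I) {FU : ProperFilter U}
  (u : I -> R) (a b : R) : (u n @[n --> U] --> a) -> (u n @[n --> U] --> b) -> a = b.
Proof.
by move=> ua ub; apply: cvg_unique ua ub.
Qed.

Definition lipschitz_dist (R : realType) (T : Type) (dist : T -> T -> R) (f : T -> R) :=
  exists2 L, 0 <= L & forall x y, `|f x - f y| <= L * dist x y.

Section itineraries.
Context d (Y : measurableType d) (R : realType) (dY : Y -> Y -> R) (B : nat -> set Y).

(** The cells of level [k] are the atoms of the partition generated by the first [k] sets of [B].
    With the newest digit first, as for words, dropping digits passes to a coarser partition. *)
Fixpoint itinerary (k : nat) (y : Y) : seq bool :=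
  if k is k'.+1 then `[< B k' y >] :: itinerary k' y else [::].

(** A combinatorial form of total boundedness: at some level, all of the finitely many cells are
    small. *)
Definition itinerary_separates :=
  forall e : R, 0 < e -> exists K, forall y y', itinerary K y = itinerary K y' -> dY y y' < e.

Hypothesis mB : forall k, measurable (B k).
Hypothesis sepB : itinerary_separates.

Lemma size_itinerary k y : size (itinerary k y) = k.
Proof. by elim: k => //= k ->. Qed.

Lemma drop_itinerary j k y : drop j (itinerary (j + k) y) = itinerary k y.
Proof. by elim: j => [|j IHj]; rewrite ?drop0. Qed.

Lemma measurable_cell k w : measurable [set y | itinerary k y = w].
Proof.
elim: k w => [|k IHk] [|b w].
- by rewrite (_ : mkset _ = setT)//; apply/seteqP; split.
- by rewrite (_ : mkset _ = set0)//; apply/seteqP; split.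
- by rewrite (_ : mkset _ = set0)//; apply/seteqP; split.
rewrite (_ : mkset _ = (if b then B k else ~` B k) `&` [set y | itinerary k y = w]).
  by apply: measurableI => //; case: b => //; exact: measurableC.
apply/seteqP; split=> y /=.
  by move=> [<- ->]; split=> //; case: asboolP.
by case: b => -[By ->]; [rewrite asboolT|rewrite asboolF].
Qed.

(* Junk when the cell of [w] is empty; [itinerary_rep] is the guarded specification. *)
Definition rep (w : seq bool) : Y := get [set y | itinerary (size w) y = w].

Lemma itinerary_rep w y : itinerary (size w) y = w -> itinerary (size w) (rep w) = w.
Proof. by move=> wy; exact: (@getPex _ [set y | itinerary (size w) y = w] (ex_intro _ y wy)). Qed.

Lemma itinerary_rep_itinerary k y : itinerary k (rep (itinerary k y)) = itinerary k y.
Proof. by have := @itinerary_rep (itinerary k y) y; rewrite !size_itinerary; exact. Qed.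

Lemma itinerary_separates_level (e : nat -> R) : (forall m, 0 < e m) ->
  exists K : nat -> nat, {homo K : m n / (m <= n)%N} /\
    forall m y y', itinerary (K m) y = itinerary (K m) y' -> dY y y' < e m.
Proof.
move=> e0; have /choice[K0 K0E] m := sepB (e0 m).
(* Partial sums make the levels monotone in [m] while keeping level [m] at least [K0 m]. *)
exists (fun m => \sum_(i < m.+1) K0 i)%N; split=> [m n mn|m y y'].
  rewrite -(subnKC mn) -addSn -!(big_mkord xpredT) /index_iota !subn0.
  by rewrite iotaD big_cat/= leq_addr.
rewrite big_ord_recr /= => /(congr1 (drop (\sum_(i < m) K0 i))).
by rewrite !drop_itinerary => /K0E.
Qed.

(** [F] is a pointwise limit of functions constant on cells. This works for the product
    sigma-algebra on [X * X] without relating it to the open sets of a product metric. *)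
Lemma lipschitz_measurable F : lipschitz_dist dY F -> measurable_fun setT F.
Proof.
move=> [L L0 FL]; pose e m : R := m.+1%:R^-1.
have [//|K [_ KE]] := @itinerary_separates_level e.
  by move=> m; rewrite /e invr_gt0 ltr0n.
apply: (@measurable_fun_cvg _ _ _ _ (fun m y => F (rep (itinerary (K m) y)))).
  move=> m; apply: (word_fun_measurable (c := itinerary (K m)) (k := K m) _ _ (F \o rep)).
    exact: size_itinerary.
  exact: measurable_cell.
move=> y _; apply/cvgrPdist_le => eps eps0.
have : (L * e m) @[m --> \oo] --> L * 0.
  by apply: cvgMr; exact: cvg_harmonic.
rewrite mulr0 => /cvgrPdist_le/(_ _ eps0); apply: filterS => m.
rewrite sub0r normrN ger0_norm; last by rewrite mulr_ge0// ltW// invr_gt0.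
apply: le_trans; apply: le_trans (FL _ _) _; rewrite ler_wpM2l// ltW//.
by apply: KE; rewrite itinerary_rep_itinerary.
Qed.

Lemma lipschitz_bounded F : lipschitz_dist dY F -> exists M, forall y, `|F y| <= M.
Proof.
move=> [L L0 FL]; have [K KE] := sepB ltr01.
(* Each point lies within distance 1 of the representative of its cell, and there are finitely many
   representatives. *)
exists (\sum_(w : K.-tuple bool) `|F (rep w)| + L) => y.
have sk : size (itinerary K y) == K by rewrite size_itinerary.
rewrite (bigD1 (Tuple sk))//= -addrA.
have := FL y (rep (itinerary K y)).
have : L * dY y (rep (itinerary K y)) <= L.
  by rewrite ler_piMr// ltW// KE// itinerary_rep_itinerary.
have : 0 <= \sum_(w : K.-tuple bool | w != Tuple sk) `|F (rep w)|.
  by apply: sumr_ge0.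
have := ler_dist_dist (F y) (F (rep (itinerary K y))).
have := ler_norm (`|F y| - `|F (rep (itinerary K y))|).
lra.
Qed.

Lemma lipschitz_bmeas F : lipschitz_dist dY F -> bmeas F.
Proof. by move=> lF; split; [exact: lipschitz_measurable|exact: lipschitz_bounded]. Qed.

Lemma dist_word_integral (P : probability Y R) F L k (e : R) :
  (forall y y', `|F y - F y'| <= L * dY y y') -> 0 <= L ->
  (forall y y', itinerary k y = itinerary k y' -> dY y y' < e) -> bmeas F ->
  `|\int[P]_y F y - \sum_(w : k.-tuple bool) F (rep w) * fine (P [set y | itinerary k y = w])|
    <= L * e.
Proof.
move=> FL L0 ke bF.
rewrite -(word_integral (size_itinerary k) (measurable_cell k) P (F \o rep)).
have := @dist_bint _ _ _ P (probability_lty P) F (fun y => F (rep (itinerary k y))) (L * e).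
rewrite [X in fine X](@probability_setT _ _ _ P) mulr1; apply=> //.
  exact: (word_fun_bmeas (size_itinerary k) (measurable_cell k) (F \o rep)).
move=> y; apply: le_trans (FL _ _) _; rewrite ler_wpM2l// ltW//.
by apply: ke; rewrite itinerary_rep_itinerary.
Qed.

Hypothesis dYC : forall x y, dY x y = dY y x.
Hypothesis dYD : forall x y z, dY x z <= dY x y + dY y z.
Hypothesis dY_complete : forall (S : nat -> Y) (e : nat -> R),
  (forall m l, (m <= l)%N -> dY (S l) (S m) <= e m) -> exists y, forall m, dY y (S m) <= e m.
Hypothesis dY_borel : forall e (T : measurableType e) (f : T -> Y),
  (forall G, dopen dY G -> measurable (f @^-1` G)) -> measurable_fun setT f.

(** The limit masses [p] are consistent along the nested partitions but only finitely additive;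
    countable additivity is inherited from Lebesgue measure. A point may be sent outside its cells,
    onto their boundary, so [pi] need not give the cells the masses [p]. Only integrals of Lipschitz
    functions are therefore compared. *)
Theorem weak_compactness (U : set_system nat) (pis : nat -> probability Y R) :
  UltraFilter U ->
  exists pi : probability Y R, forall F, lipschitz_dist dY F ->
    \int[pis n]_y F y @[n --> U] --> \int[pi]_y F y.
Proof.
move=> UU.
have /choice[p pE] w : exists l : R,
    fine (pis n [set y | itinerary (size w) y = w]) @[n --> U] --> l.
  apply: (@ultra_cvg_bounded _ _ _ _ 1) => n.
  rewrite ger0_norm ?fine_ge0// -[leRHS]/(fine 1%E) fine_le//.
    by apply: fin_num_measure; exact: measurable_cell.
  by apply: probability_le1; exact: measurable_cell.
have mcell w : measurable [set y | itinerary (size w) y = w] by exact: measurable_cell.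
have p_ge0 w : 0 <= p w.
  by apply: cvgr_to_ge (pE w) _; apply: nearW => n; exact: fine_ge0.
have p_nil : p [::] = 1.
  apply: (cvg_uniqR (pE [::])); rewrite (_ : mkset _ = setT).
    by under eq_fun do rewrite probability_setT; exact: cvg_cst.
  by apply/seteqP; split.
have p_split w : p w = p (false :: w) + p (true :: w).
  apply: (cvg_uniqR (pE w)); under eq_fun => n.
    rewrite (_ : mkset _ = [set y | itinerary (size w).+1 y = false :: w] `|`
                           [set y | itinerary (size w).+1 y = true :: w]); last first.
      apply/seteqP; split=> y /=; last by move=> [] [].
      by move=> ->; case: asboolP => _; [right|left].
    rewrite measureU; [|exact: (mcell (false :: w))|exact: (mcell (true :: w))|]; last first.
      by apply/seteqP; split=> y //= [] [-> _] [].
    rewrite fineD; [|by apply: fin_num_measure; exact: (mcell (_ :: w))..].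
    over.
  exact: cvgD (pE (false :: w)) (pE (true :: w)).
have [P [W [size_W W_S mW PW W_gt0]]] := coin_space p_nil p_ge0 p_split.
have mWk k w : measurable [set t | W k t = w].
  have [<-|wk] := eqVneq (size w) k; first exact: mW.
  rewrite (_ : mkset _ = set0)//; apply/seteqP; split=> t //= Wt.
  by move: wk; rewrite -Wt size_W eqxx.
have drop_W j k t : drop j (W (j + k)%N t) = W k t.
  elim: j => [|j IHj]; first by rewrite drop0.
  by rewrite addSn; have [b ->] := W_S (j + k)%N t.
(* A word reached by [W] has positive limit mass, so its cell is not empty and [rep] really lies in
   it. *)
have itinerary_W k t : itinerary k (rep (W k t)) = W k t.
  have [y Wy] : exists y, itinerary k y = W k t.
    apply: contrapT => noy; have := W_gt0 k t.
    rewrite (cvg_uniqR (pE (W k t)) (_ : _ @[n --> U] --> 0)) ?ltxx//.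
    rewrite size_W (_ : mkset _ = set0); last first.
      by apply/seteqP; split=> y //= yW; apply: noy; exists y.
    by under eq_fun do rewrite measure0; exact: cvg_cst.
  by have := @itinerary_rep (W k t) y; rewrite size_W; exact.
pose e m : R := m.+1%:R^-1.
have e0 m : 0 < e m by rewrite /e invr_gt0 ltr0n.
have ecvg : e m @[m --> \oo] --> 0 by exact: cvg_harmonic.
have [K [Kmono KE]] := itinerary_separates_level e0.
(* The representatives of the nested cells attached to [t] form a Cauchy sequence with rate [e];
   [T t] is its limit. *)
have /choice[T TE] t : exists y, forall m, dY y (rep (W (K m) t)) <= e m.
  apply: dY_complete => m l ml; apply: ltW; apply: KE; rewrite itinerary_W.
  by rewrite -(subnK (Kmono _ _ ml)) -(drop_itinerary (K l - K m)) itinerary_W drop_W.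
have mT : measurable_fun setT T.
  apply: dY_borel => G Gopen.
  (* The radius [2 * e m] exceeds the distance [e m] from the representative to [T t], so the ball
     contains [T t]; conversely the ball is within [3 * e m] of [T t], hence inside [G] for large
     [m]. *)
  rewrite (_ : T @^-1` G = \bigcup_m
    [set t | dball dY (rep (W (K m) t)) (2 * e m) `<=` G]).
    apply: bigcup_measurable => m _.
    exact: (word_measurable (c := W (K m)) (size_W (K m)) (mWk (K m))
              (fun w => dball dY (rep w) (2 * e m) `<=` G)).
  apply/seteqP; split=> t /=.
    move=> /Gopen[r r0 rG].
    have [m /= em] : exists m, 3 * e m < r.
      have r3 : 0 < r / 3 by rewrite divr_gt0.
      have /cvgr_lt/(_ _ r3)[m _ /(_ m (leqnn m))/=] := ecvg.
      by exists m; lra.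
    exists m => // y yb; apply: rG; rewrite /dball /= in yb *.
    by have := TE t m; have := dYD (T t) (rep (W (K m) t)) y; lra.
  move=> [m _]; apply; rewrite /dball /= dYC; have := TE t m.
  by have := e0 m; lra.
have [pi [_ piE]] := push_probability P mT.
exists pi => F lF; have bF := lipschitz_bmeas lF; case: lF => L L0 FL.
rewrite (bint_transfer mT piE bF); apply/cvgrPdist_le => eps eps0.
(* Three errors of [eps / 3]: discretizing the integral against [pi], discretizing the one against
   [pis n], and the convergence of the finite sum in between. *)
have [m em] : exists m, L * e m <= eps / 3.
  have : (L * e m) @[m --> \oo] --> L * 0 by exact: cvgMr.
  have e3 : 0 < eps / 3 by rewrite divr_gt0.
  rewrite mulr0 => /cvgr_le/(_ _ e3)[m _ /(_ m (leqnn m))/= ?].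
  by exists m.
have bFT : bmeas (fun t => F (T t)).
  case: bF => mF [M FM]; split; last by exists M.
  exact: measurableT_comp mF mT.
have FTE : `|\int[P]_t F (T t) -
    \sum_(w : (K m).-tuple bool) F (rep w) * p w| <= L * e m.
  rewrite (eq_bigr (fun w : (K m).-tuple bool =>
      F (rep w) * fine (P [set t | W (K m) t = w]))); last first.
    by move=> w _; have := PW w; rewrite size_tuple => ->.
  rewrite -(word_integral (size_W (K m)) (mWk (K m)) P (F \o rep)).
  have := @dist_bint _ _ _ P (probability_lty P) (F \o T)
    (fun t => F (rep (W (K m) t))) (L * e m).
  rewrite [X in fine X](@probability_setT _ _ _ P) mulr1; apply=> //.
    exact: (word_fun_bmeas (size_W (K m)) (mWk (K m)) (F \o rep)).
  by move=> t; apply: le_trans (FL _ _) _; rewrite ler_wpM2l.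
have : (\sum_(w : (K m).-tuple bool) F (rep w) *
    fine (pis n [set y | itinerary (K m) y = w])) @[n --> U] -->
    \sum_(w : (K m).-tuple bool) F (rep w) * p w.
  apply: cvg_sumR => w; apply: cvgMr.
  by have := pE w; rewrite size_tuple.
have e3 : 0 < eps / 3 by rewrite divr_gt0.
move=> /cvgrPdist_le/(_ _ e3); apply: filterS => n.
have := @dist_word_integral (pis n) F L (K m) (e m) FL L0 (KE m) bF.
move: em FTE; rewrite !ler_norml => ? /andP[? ?] /andP[? ?] /andP[? ?].
by apply/andP; lra.
Qed.

End itineraries.

Lemma itinerary_bit d (Y : measurableType d) (B : nat -> set Y) K y y' k :
  itinerary B K y = itinerary B K y' -> (k < K)%N -> B k y <-> B k y'.
Proof.
elim: K => // K IHK /= [BB /IHK {}IHK]; rewrite ltnS leq_eqVlt => /predU1P[->|//].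
by split=> By; apply/asboolP; [rewrite -BB|rewrite BB]; exact/asboolP.
Qed.

Lemma eq_itinerary d (Y : measurableType d) (B : nat -> set Y) K y y' :
  (forall k, (k < K)%N -> B k y <-> B k y') -> itinerary B K y = itinerary B K y'.
Proof.
elim: K => //= K IHK BB; rewrite IHK; last by move=> k kK; apply: BB; exact: ltnW.
by congr (_ :: _); apply: asbool_equiv_eq; exact: BB.
Qed.

(** * Compact metric spaces *)

Section compact_metric_space.
Context d (X : measurableType d) (R : realType) (dist : X -> X -> R).
Hypothesis dist_metric : is_metric dist.
Hypothesis dist_compact : dcompact dist.
Hypothesis dist_borel : borel_of dist.

Let distxx x : dist x x = 0.
Proof. by case: dist_metric => d0 _ _; apply/d0. Qed.

Let distC x y : dist x y = dist y x.
Proof. by case: dist_metric. Qed.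

Let distD x y z : dist x z <= dist x y + dist y z.
Proof. by case: dist_metric. Qed.

Lemma dist_ge0 x y : 0 <= dist x y.
Proof. by have := distD x y x; rewrite distxx (distC y x); lra. Qed.

Lemma dist_dist x y x' y' : `|dist x y - dist x' y'| <= dist x x' + dist y y'.
Proof.
rewrite ler_norml; apply/andP.
have := (distD x x' y, distD x' y' y, distD x' x y', distD x y y').
by rewrite (distC y' y) (distC x' x) => -[[[? ?] ?] ?]; lra.
Qed.

Lemma dopen_dball x r : dopen dist (dball dist x r).
Proof.
move=> y; rewrite /dball /= => xy; exists (r - dist x y); first by rewrite subr_gt0.
by move=> z /=; have := distD x y z; lra.
Qed.

Lemma dopen_measurable G : dopen dist G -> measurable G.
Proof. by move=> oG; rewrite dist_borel; exact: sub_sigma_algebra. Qed.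

Lemma borel_measurable_fun e (T : measurableType e) (f : T -> X) :
  (forall G, dopen dist G -> measurable (f @^-1` G)) -> measurable_fun setT f.
Proof.
move=> fG; apply: (measurability (dopen dist)) => //.
by move=> _ [G oG <-]; rewrite setTI; exact: fG.
Qed.

Lemma finite_ball_cover (r : R) : 0 < r ->
  exists (N : nat) (c : 'I_N -> X), forall x, exists i, dist (c i) x < r.
Proof.
move=> r0; have [|x _|N [c cP]] := @dist_compact X (fun x => dball dist x r).
- by move=> x; exact: dopen_dball.
- by exists x => //; rewrite /dball /= distxx.
- by exists N, c => x; have [i _ ?] := cP x I; exists i.
Qed.

(** Otherwise the open sets of points farther than [e m] from [S m] cover the space; the term of [S]
    at the largest index of a finite subcover lies in none of them. *)
Lemma dist_complete (S : nat -> X) (e : nat -> R) :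
  (forall m l, (m <= l)%N -> dist (S l) (S m) <= e m) ->
  exists y, forall m, dist y (S m) <= e m.
Proof.
move=> Se; apply: contrapT => noy.
have [m||N [g gP]] := @dist_compact nat (fun m => [set y | e m < dist y (S m)]).
- move=> y /= ey; exists (dist y (S m) - e m); first by rewrite subr_gt0.
  by move=> z; rewrite /dball /=; have := distD y z (S m); lra.
- move=> y _; apply: contrapT => yP; apply: noy; exists y => m.
  by rewrite leNgt; apply/negP => em; apply: yP; exists m.
have [i _ /=] := gP (S (\max_i g i)) I.
by rewrite ltNge Se//; exact: (leq_bigmax i).
Qed.

(** The balls of radius [1 / (m + 1)] over finite nets, enumerated by [pickle]. That [K] does not
    depend on [y] makes itineraries separate points at a fixed level; the same sets express open
    sets as countable unions of balls. *)
Lemma countable_uniform_base : exists B : nat -> set X,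
  (forall k, B k = set0 \/ exists c r, B k = dball dist c r) /\
  forall e : R, 0 < e -> exists K, forall y,
    exists k, [/\ (k < K)%N, B k y & forall y', B k y' -> dist y y' < e].
Proof.
have cov m : exists s : {N : nat & 'I_N -> X},
    forall x, exists i, dist (projT2 s i) x < m.+1%:R^-1.
  have [|N [c cP]] := @finite_ball_cover m.+1%:R^-1; first by rewrite invr_gt0.
  by exists (existT _ N c).
have [s sP] := choice cov.
pose N m := projT1 (s m); pose c m : 'I_(N m) -> X := projT2 (s m).
pose ball m j := [set y | exists2 i : 'I_(N m), val i = j & dist (c m i) y < m.+1%:R^-1].
pose B k := if @unpickle (nat * nat)%type k is Some (m, j) then ball m j else set0.
have ballE m i : ball m (val i) = dball dist (c m i) m.+1%:R^-1.
  apply/seteqP; split=> y /=; last by exists i.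
  by move=> [i' /val_inj ->].
exists B; split.
  move=> k; rewrite /B; case: unpickle => [[m j]|]; last by left.
  have [jN|Nj] := ltnP j (N m).
    by right; exists (c m (Ordinal jN)), m.+1%:R^-1; rewrite -ballE.
  left; apply/seteqP; split=> y //= [i ij _].
  by have := ltn_ord i; rewrite ij ltnNge Nj.
move=> e e0.
have [m em] : exists m, m.+1%:R^-1 < e / 2.
  have e2 : 0 < e / 2 by rewrite divr_gt0.
  have /cvgr_lt/(_ _ e2)[m _ /(_ m (leqnn m))/=] := @cvg_harmonic R.
  by exists m.
exists (\max_(j < N m) (pickle (m, val j)).+1)%N => y.
have [i iy] := sP m y.
have Bi : B (pickle (m, val i)) = dball dist (c m i) m.+1%:R^-1.
  by rewrite /B pickleK ballE.
exists (pickle (m, val i)); split.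
- exact: (leq_bigmax (F := fun j : 'I_(N m) => (pickle (m, val j)).+1) i).
- by rewrite Bi.
- rewrite Bi => y'; rewrite /dball /= => iy'.
  have := distD y (c m i) y'; rewrite (distC y (c m i)); 
  move=> h; apply: le_lt_trans h _; rewrite [ltRHS]splitr.
  by apply: ltrD; exact: lt_trans em.
Qed.

Lemma compact_itinerary : exists B : nat -> set X,
  (forall k, measurable (B k)) /\ itinerary_separates dist B.
Proof.
have [B [Bball Bbase]] := countable_uniform_base; exists B; split.
  move=> k; case: (Bball k) => [->|[c [r ->]]]; first exact: measurable0.
  by apply: dopen_measurable; exact: dopen_dball.
move=> e e0; have [K KP] := Bbase e e0; exists K => y y' yy'.
have [k [kK By]] := KP y; apply.
by rewrite -(itinerary_bit yy' kK).
Qed.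

Lemma lipschitz1_bmeas F : lipschitz_dist dist F -> bmeas F.
Proof.
by have [B [mB sB]] := compact_itinerary; exact: lipschitz_bmeas mB sB _.
Qed.

Definition max_dist (z z' : X * X) := Num.max (dist z.1 z'.1) (dist z.2 z'.2).

(** Interleaving: even indices test the first coordinate and odd ones the second, so [K.*2] digits
    determine [K] digits of each. *)
Lemma compact_itinerary2 : exists B : nat -> set (X * X),
  (forall k, measurable (B k)) /\ itinerary_separates max_dist B.
Proof.
have [B [mB sB]] := compact_itinerary.
exists (fun k => if odd k then snd @^-1` (B k./2) else fst @^-1` (B k./2)); split.
  move=> k; case: ifP => _; rewrite -[X in measurable X]setTI.
    exact: measurable_snd.
  exact: measurable_fst.
move=> e e0; have [K KE] := sB e e0; exists K.*2 => z z' zz'.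
rewrite /max_dist gt_max !KE//; apply: eq_itinerary => k kK.
- have := itinerary_bit zz' (_ : k.*2.+1 < K.*2)%N; rewrite /= odd_double /= uphalf_double.
  by apply; rewrite -doubleS leq_double.
- have := itinerary_bit zz' (_ : k.*2 < K.*2)%N; rewrite odd_double /= doubleK.
  by apply; rewrite ltn_double.
Qed.

Lemma lipschitz2_bmeas F : lipschitz_dist max_dist F -> bmeas F.
Proof.
by have [B [mB sB]] := compact_itinerary2; exact: lipschitz_bmeas mB sB _.
Qed.

Lemma weak_compactness2 (U : set_system nat) (pis : nat -> probability (X * X)%type R) :
  UltraFilter U ->
  exists pi : probability (X * X)%type R, forall F, lipschitz_dist max_dist F ->
    \int[pis n]_y F y @[n --> U] --> \int[pi]_y F y.
Proof.
move=> UU; have [B [mB sB]] := compact_itinerary2.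
apply: (weak_compactness mB sB) => //.
- by move=> z z'; rewrite /max_dist (distC z.1) (distC z.2).
- move=> x y z; rewrite /max_dist ge_max; apply/andP; split.
    by apply: le_trans (distD _ y.1 _) _; apply: lerD; rewrite le_max lexx.
  by apply: le_trans (distD _ y.2 _) _; apply: lerD; rewrite le_max lexx orbT.
- move=> S e Se.
  have [m l ml|y1 y1E] := @dist_complete (fun n => (S n).1) e.
    by apply: le_trans (Se _ _ ml); rewrite le_max lexx.
  have [m l ml|y2 y2E] := @dist_complete (fun n => (S n).2) e.
    by apply: le_trans (Se _ _ ml); rewrite le_max lexx orbT.
  by exists (y1, y2) => m; rewrite /max_dist ge_max y1E y2E.
(* Measurability is checked on each coordinate, since cylinders over open sets are open for
   [max_dist]. *)
- move=> e T f fG; apply/measurable_fun_pairP; split; apply: borel_measurable_fun => G oG.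
    apply: (fG (fst @^-1` G)) => z /= /oG[r r0 rG]; exists r => // z'.
    by rewrite /dball /max_dist /= gt_max => /andP[? _]; exact: rG.
  apply: (fG (snd @^-1` G)) => z /= /oG[r r0 rG]; exists r => // z'.
  by rewrite /dball /max_dist /= gt_max => /andP[_ ?]; exact: rG.
Qed.

Lemma dist_lipschitz : lipschitz_dist max_dist (fun z => dist z.1 z.2).
Proof.
exists 2 => // z z'; apply: le_trans (dist_dist _ _ _ _) _.
by rewrite mulr_natl mulr2n; apply: lerD; rewrite le_max lexx ?orbT.
Qed.

Lemma dist_bounded : exists2 D, 0 <= D & forall x y, dist x y <= D.
Proof.
have [_ [D DP]] := lipschitz2_bmeas dist_lipschitz.
exists D => [|x y]; first exact: le_trans (DP (point, point)).
exact: le_trans (ler_norm _) (DP (x, y)).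
Qed.

Lemma dist_sq_lipschitz : lipschitz_dist max_dist (fun z => dist z.1 z.2 ^+ 2).
Proof.
have [L L0 LP] := dist_lipschitz; have [D D0 DP] := dist_bounded.
exists (2 * D * L) => [|z z']; first by rewrite !mulr_ge0.
rewrite subr_sqr normrM mulrC -mulrA ler_pM//.
rewrite ger0_norm ?addr_ge0 ?dist_ge0// mulr_natl mulr2n.
by apply: lerD; exact: DP.
Qed.

Lemma dist_sq_bmeas : bmeas (fun z : X * X => dist z.1 z.2 ^+ 2).
Proof. exact: lipschitz2_bmeas dist_sq_lipschitz. Qed.

Lemma lipschitz_fst F : lipschitz_dist dist F -> lipschitz_dist max_dist (F \o fst).
Proof.
move=> [L L0 FL]; exists L => // z z'; apply: le_trans (FL _ _) _.
by rewrite ler_wpM2l// le_max lexx.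
Qed.

Lemma lipschitz_snd F : lipschitz_dist dist F -> lipschitz_dist max_dist (F \o snd).
Proof.
move=> [L L0 FL]; exists L => // z z'; apply: le_trans (FL _ _) _.
by rewrite ler_wpM2l// le_max lexx orbT.
Qed.

End compact_metric_space.

(** * Calculus of Lipschitz functions *)

Lemma ler_dist_max (R : realDomainType) (a b c d : R) :
  `|Num.max a b - Num.max c d| <= `|a - c| + `|b - d|.
Proof.
have := (normr_ge0 (a - c), normr_ge0 (b - d)).
have := (ler_norm (a - c), ler_norm (b - d)).
have := (ler_norm (- (a - c)), ler_norm (- (b - d))).
rewrite !normrN => -[? ?] [? ?] [? ?].
by rewrite ler_norml; apply/andP; case: (leP a b) => ?; case: (leP c d) => ?; lra.
Qed.

Section lipschitz_calculus.
Context (R : realType) (T : Type) (dist : T -> T -> R).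
Hypothesis dist0 : forall x y, 0 <= dist x y.
Implicit Types f g : T -> R.

Local Notation lip := (lipschitz_dist dist).

Lemma lipschitz_cst c : lip (fun=> c).
Proof. by exists 0 => // x y; rewrite subrr normr0 mul0r. Qed.

Lemma lipschitzD f g : lip f -> lip g -> lip (fun x => f x + g x).
Proof.
move=> [L L0 fL] [M M0 gM]; exists (L + M) => [|x y]; first exact: addr_ge0.
rewrite opprD addrACA mulrDl (le_trans (ler_normD _ _))//.
exact: lerD.
Qed.

Lemma lipschitzZ c f : lip f -> lip (fun x => c * f x).
Proof.
move=> [L L0 fL]; exists (`|c| * L) => [|x y]; first exact: mulr_ge0.
by rewrite -mulrBr normrM -mulrA ler_wpM2l.
Qed.

Lemma lipschitzN f : lip f -> lip (fun x => - f x).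
Proof.
by move=> lf; under eq_fun do rewrite -mulN1r; exact: lipschitzZ.
Qed.

Lemma lipschitzB f g : lip f -> lip g -> lip (fun x => f x - g x).
Proof. by move=> lf lg; apply: lipschitzD => //; exact: lipschitzN. Qed.

Lemma lipschitz_sum (I : Type) (s : seq I) (h : I -> T -> R) :
  (forall i, lip (h i)) -> lip (fun x => \sum_(i <- s) h i x).
Proof.
move=> lh; elim: s => [|i s IHs].
  by under eq_fun do rewrite big_nil; exact: lipschitz_cst.
by under eq_fun do rewrite big_cons; exact: lipschitzD.
Qed.

Lemma lipschitz_max f g : lip f -> lip g -> lip (fun x => Num.max (f x) (g x)).
Proof.
move=> [L L0 fL] [M M0 gM]; exists (L + M) => [|x y]; first exact: addr_ge0.
rewrite mulrDl; apply: le_trans (lerD (fL x y) (gM x y)).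
exact: ler_dist_max.
Qed.

Lemma lipschitz_min f g : lip f -> lip g -> lip (fun x => Num.min (f x) (g x)).
Proof.
move=> lf lg; under eq_fun do rewrite -(opprK (Num.min _ _)) oppr_min.
by apply: lipschitzN; apply: lipschitz_max; exact: lipschitzN.
Qed.

Lemma lipschitzM f g M N : lip f -> lip g -> 0 <= M -> 0 <= N ->
  (forall x, `|f x| <= M) -> (forall x, `|g x| <= N) -> lip (fun x => f x * g x).
Proof.
move=> [L L0 fL] [L' L'0 gL'] M0 N0 fM gN.
exists (L * N + M * L') => [|x y]; first by rewrite addr_ge0// mulr_ge0.
rewrite (_ : _ - _ = (f x - f y) * g x + f y * (g x - g y)); last by ring.
rewrite (le_trans (ler_normD _ _))// !normrM mulrDl; apply: lerD.
  by rewrite mulrAC ler_pM.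
by rewrite -mulrA ler_pM.
Qed.

Lemma lipschitzV f c : lip f -> 0 < c -> (forall x, c <= f x) -> lip (fun x => (f x)^-1).
Proof.
move=> [L L0 fL] c0 cf; exists (c^-1 * c^-1 * L) => [|x y].
  by rewrite !mulr_ge0// invr_ge0 ltW.
have f0 z : 0 < f z by exact: lt_le_trans (cf z).
have fV z : `|(f z)^-1| <= c^-1.
  have fz0 : 0 <= (f z)^-1 by rewrite invr_ge0 ltW.
  by rewrite ger0_norm// lef_pV2 ?posrE.
rewrite (_ : _ - _ = (f x)^-1 * (f y)^-1 * (f y - f x)); last first.
  by field; rewrite !gt_eqF.
rewrite !normrM distrC -mulrA -[leRHS]mulrA -[leRHS]mulrA.
by apply: ler_pM => //; apply: ler_pM.
Qed.

Lemma lipschitz_expR f M : lip f -> (forall x, `|f x| <= M) -> lip (fun x => expR (f x)).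
Proof.
move=> [L L0 fL] fM; exists (expR M * L) => [|x y]; first by rewrite mulr_ge0// expR_ge0.
suff expRL a b : `|a| <= M -> `|b| <= M -> expR a - expR b <= expR M * `|a - b|.
  apply: (@le_trans _ _ (expR M * `|f x - f y|)); last by rewrite -mulrA ler_wpM2l ?expR_ge0.
  rewrite ler_norml lerNl opprB expRL//= andbT.
  by rewrite distrC expRL.
move=> aM bM; have := expR_tangent a b.
have : expR a * (a - b) <= expR M * `|a - b|.
  apply: le_trans (ler_wpM2l (expR_ge0 a) (ler_norm _)) _.
  by rewrite ler_wpM2r// ler_expR (le_trans (ler_norm _)).
lra.
Qed.

End lipschitz_calculus.

(** * Density of Lipschitz functions in L^1 *)

Lemma nondecreasing_tail_small d (T : measurableType d) (R : realType)
    (q : {measure set T -> \bar R}) (F : nat -> set T) (e : R) :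
  (q setT < +oo)%E -> (forall n, measurable (F n)) -> nondecreasing_seq F -> 0 < e ->
  exists n, fine (q (\bigcup_k F k `\` F n)) <= e.
Proof.
move=> qfin mF Fnd e0; pose G n := \bigcup_k F k `\` F n.
have mU : measurable (\bigcup_k F k) by exact: bigcupT_measurable.
have mG n : measurable (G n) by exact: measurableD.
have qG n : (q (G n) < +oo)%E.
  by apply: le_lt_trans qfin; apply: le_measure; rewrite ?inE.
have G0 : \bigcap_n G n = set0.
  apply/seteqP; split=> x // Gx; have [[k _ Fx] _] := Gx 0%N I.
  by have [_] := Gx k I; exact.
have : q \o G @ \oo --> q (\bigcap_n G n).
  apply: nonincreasing_cvg_mu => //; first exact: bigcapT_measurable.
  move=> m n mn; apply/subsetPset => x [Ux nF]; split=> // Fx; apply: nF.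
  by have /subsetPset := Fnd _ _ mn; exact.
rewrite G0 measure0 => /fine_cvg/cvgr_le/(_ _ e0)[n _ /(_ n (leqnn n))] ?.
by exists n.
Qed.

Section lipschitz_approximation.
Context d (X : measurableType d) (R : realType) (dist : X -> X -> R).
Hypothesis dist_metric : is_metric dist.
Hypothesis dist_compact : dcompact dist.
Hypothesis dist_borel : borel_of dist.

Let lip_bmeas := lipschitz1_bmeas dist_metric dist_compact dist_borel.

(** Measurability is included, so that the approximable sets can themselves be shown to form a
    sigma-algebra. *)
Definition lipschitz_approximable (q : {measure set X -> \bar R}) (A : set X) :=
  measurable A /\ forall e : R, 0 < e -> exists g : X -> R,
    [/\ lipschitz_dist dist g, forall x, 0 <= g x <= 1 &
        \int[q]_x `|\1_A x - g x| <= e].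

Variable q : {measure set X -> \bar R}.
Hypothesis qfin : (q setT < +oo)%E.

Let approx := lipschitz_approximable q.

Let bmeas_err A g : measurable A -> lipschitz_dist dist g ->
  bmeas (fun x => `|\1_A x - g x|).
Proof.
move=> mA lg; apply: bmeas_norm; apply: bmeasB; first exact: bmeas_indic.
exact: lip_bmeas.
Qed.

(** The pattern shared by countable unions and balls: an exhaustion from inside by [F n] costs only
    the mass of the tail, which is small for large [n]. *)
Let approx_tail (F : nat -> set X) A : nondecreasing_seq F -> \bigcup_k F k = A ->
  (forall n, measurable (F n)) ->
  (forall n e, 0 < e -> exists g : X -> R,
    [/\ lipschitz_dist dist g, forall x, 0 <= g x <= 1 &
        \int[q]_x `|\1_A x - g x| <= \int[q]_x \1_(A `\` F n) x + e]) ->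
  approx A.
Proof.
move=> Fnd FA mF FP; split; first by rewrite -FA; exact: bigcupT_measurable.
move=> e e0; have e2 : 0 < e / 2 by rewrite divr_gt0.
have [n] := nondecreasing_tail_small qfin mF Fnd e2.
have [g [lg g01 gA]] := FP n _ e2; rewrite FA => Fn; exists g; split=> //.
apply: le_trans gA _; rewrite [leRHS]splitr lerD2r bint_indic//.
by apply: measurableD => //; rewrite -FA; exact: bigcupT_measurable.
Qed.

Let approx0 : approx set0.
Proof.
split=> // e e0; exists (fun=> 0); split; first exact: lipschitz_cst.
  by move=> x; rewrite lexx ler01.
under eq_Rintegral do rewrite indic0 subrr normr0.
by rewrite bint_cst mul0r ltW.
Qed.

Let approxC A : approx A -> approx (~` A).
Proof.
move=> [mA hA]; split; first exact: measurableC.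
move=> e /hA[g [lg g01 gA]]; exists (fun x => 1 - g x); split.
- by apply: lipschitzB => //; exact: lipschitz_cst.
- by move=> x; have := g01 x; lra.
- under eq_Rintegral => x _.
    rewrite (_ : `|_| = `|\1_A x - g x|); first over.
    rewrite -normrN; congr `|_|; rewrite !indicE in_setC.
    by case: (x \in A) => /=; ring.
  exact: gA.
Qed.

Let approxU A B : approx A -> approx B -> approx (A `|` B).
Proof.
move=> [mA hA] [mB hB]; split; first exact: measurableU.
move=> e e0; have e2 : 0 < e / 2 by rewrite divr_gt0.
have [g [lg g01 gA]] := hA _ e2; have [g' [lg' g'01 gB]] := hB _ e2.
exists (fun x => Num.max (g x) (g' x)); split; first exact: lipschitz_max.
  by move=> x; have := g01 x; have := g'01 x; case: (leP (g x) (g' x)) => _; lra.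
rewrite [leRHS]splitr; apply: le_trans (lerD gA gB).
rewrite -bintD//; [|exact: bmeas_err..].
apply: le_bint => //.
- by apply: bmeas_err; [exact: measurableU|exact: lipschitz_max].
- by apply: bmeasD; exact: bmeas_err.
move=> x; rewrite (_ : \1_(A `|` B) x = Num.max (\1_A x) (\1_B x)).
  exact: ler_dist_max.
rewrite !indicE in_setU; case: (x \in A); case: (x \in B); rewrite /= ?maxxx//.
  by rewrite max_l ?ler01.
by rewrite max_r ?ler01.
Qed.

Let approx_bigcup (A : nat -> set X) : (forall n, approx (A n)) -> approx (\bigcup_n A n).
Proof.
move=> hA; have hF n : approx (\big[setU/set0]_(i < n) A i).
  by elim/big_ind : _ => //; exact: approxU.
apply: (@approx_tail (fun n => \big[setU/set0]_(i < n.+1) A i)).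
- move=> m n mn; apply/subsetPset; rewrite -!bigcup_mkord => x [k km Ak].
  by exists k => //=; exact: leq_trans km _.
- by rewrite bigcup_bigsetU_bigcup.
- by move=> n; case: (hF n.+1).
move=> n e e0; have [mF /(_ _ e0)[g [lg g01 gF]]] := hF n.+1; exists g; split=> //.
set F := \big[setU/set0]_(i < n.+1) A i in mF gF *.
have mU : measurable (\bigcup_n A n) by apply: bigcupT_measurable => k; case: (hA k).
have FU : F `<=` \bigcup_k A k.
  by rewrite /F -bigcup_mkord => x [k _ Ak]; exists k.
apply: le_trans (_ : _ <= \int[q]_x (\1_(\bigcup_k A k `\` F) x + `|\1_F x - g x|)) _.
  apply: le_bint => //; first exact: bmeas_err.
    by apply: bmeasD; [apply: bmeas_indic; exact: measurableD|exact: bmeas_err].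
  move=> x; rewrite (_ : \1_(\bigcup_k A k) x - g x =
    \1_(\bigcup_k A k `\` F) x + (\1_F x - g x)).
    by apply: le_trans (ler_normD _ _) _; rewrite lerD2r ger0_norm.
  rewrite addrA; congr (_ - _); rewrite !indicE in_setD.
  have [xF|xF] := boolP (x \in F); last by rewrite andbT addr0.
  by rewrite andbF add0r mem_set//; apply: FU; rewrite inE in xF.
rewrite bintD ?lerD2l//; [|exact: bmeas_err].
by apply: bmeas_indic; exact: measurableD.
Qed.

Let approx_ball c r : approx (dball dist c r).
Proof.
have distD : forall x y z, dist x z <= dist x y + dist y z by case: dist_metric.
have distC : forall x y, dist x y = dist y x by case: dist_metric.
pose h x := r - dist c x.
have lh : lipschitz_dist dist h.
  exists 1 => // x y; rewrite mul1r /h ler_norml.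
  by have := distD c x y; have := distD c y x; rewrite (distC y x) => ? ?; apply/andP; lra.
pose F n := [set x | n.+1%:R^-1 <= h x].
(* [g n] equals 1 on [F n] and 0 outside the ball, so it differs from the indicator only on the
   tail. *)
pose g n x := Num.max 0 (Num.min 1 (n.+1%:R * h x)).
have n0 n : (0 : R) < n.+1%:R by rewrite ltr0n.
apply: (@approx_tail F).
- move=> m n mn; apply/subsetPset => x; rewrite /F /=; apply: le_trans.
  by rewrite lef_pV2 ?posrE// ler_nat.
- apply/seteqP; split=> x; rewrite /dball /F /h /=.
    move=> [n _ /=]; rewrite -subr_gt0; apply: lt_le_trans.
    by rewrite invr_gt0.
  rewrite -subr_gt0 => hx.
  have /cvgr_lt/(_ _ hx)[n _ /(_ n (leqnn n))/=] := @cvg_harmonic R.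
  by exists n => //=; exact: ltW.
- move=> n; rewrite /F -[X in measurable X]setTI.
  have [mh _] := lip_bmeas lh.
  rewrite (_ : mkset _ = h @^-1` `[n.+1%:R^-1, +oo[%classic).
    by apply: mh => //; exact: measurable_itv.
  by apply/seteqP; split=> x /=; rewrite in_itv/= andbT.
move=> n e e0.
have lg : lipschitz_dist dist (g n).
  apply: lipschitz_max; first exact: lipschitz_cst.
  by apply: lipschitz_min; [exact: lipschitz_cst|exact: lipschitzZ].
exists (g n); split=> //.
  by move=> x; rewrite le_max lexx/= ge_max ler01/= ge_min lexx.
have mB : measurable (dball dist c r) by apply: (dopen_measurable dist_borel); exact: dopen_dball.
have mF : measurable (F n).
  rewrite /F -[X in measurable X]setTI.
  have [mh _] := lip_bmeas lh.
  rewrite (_ : mkset _ = h @^-1` `[n.+1%:R^-1, +oo[%classic).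
    by apply: mh => //; exact: measurable_itv.
  by apply/seteqP; split=> x /=; rewrite in_itv/= andbT.
have le_e : \int[q]_x \1_(dball dist c r `\` F n) x <=
    \int[q]_x \1_(dball dist c r `\` F n) x + e by rewrite lerDl ltW.
apply: le_trans le_e; apply: le_bint => //; first exact: bmeas_err.
  by apply: bmeas_indic; exact: measurableD.
move=> x; rewrite !indicE in_setD /g.
have [xF|xF] := boolP (x \in F n).
  have {}xF : 1 <= n.+1%:R * h x.
    by move: xF; rewrite inE /F /= -(ler_pM2l (n0 n)) divff ?gt_eqF.
  have xB : x \in dball dist c r.
    rewrite inE /dball /= -subr_gt0 -(pmulr_rgt0 _ (n0 n)).
    exact: lt_le_trans xF.
  by rewrite xB min_l// max_r// subrr normr0.
have [xB|xB] := boolP (x \in dball dist c r) => /=.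
  rewrite ler_norml; apply/andP.
  have : 0 <= Num.max 0 (Num.min 1 (n.+1%:R * h x)) <= 1.
    by rewrite le_max lexx/= ge_max ler01/= ge_min lexx.
  lra.
rewrite max_l ?subrr ?normr0// ge_min; apply/orP; right.
rewrite pmulr_rle0// subr_le0 leNgt; apply/negP => xr.
by move/negP : xB; apply; rewrite inE.
Qed.

(** The approximable sets form a sigma-algebra containing the balls, and every open set is a
    countable union of balls of the uniform base. *)
Lemma lipschitz_dense A : measurable A -> approx A.
Proof.
rewrite dist_borel; apply: smallest_sub; first split.
- exact: approx0.
- by move=> B /approxC; rewrite setTD.
- exact: approx_bigcup.
move=> G oG.
have [B [Bball Bbase]] := countable_uniform_base dist_metric dist_compact.
rewrite (_ : G = \bigcup_k if `[< B k `<=` G >] then B k else set0).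
  apply: approx_bigcup => k; case: ifP => _ //.
  by case: (Bball k) => [->|[c [r ->]]].
apply/seteqP; split=> x.
  move=> /oG[r r0 rG]; have [K KP] := Bbase r r0.
  have [k [_ Bx By]] := KP x; exists k => //.
  by rewrite asboolT// => y /By; exact: rG.
by move=> [k _]; case: asboolP => // BG; exact: BG.
Qed.

End lipschitz_approximation.

Lemma bint_measure_add d (T : measurableType d) (R : realType)
    (m1 m2 : {measure set T -> \bar R}) (h : T -> R) :
  (m1 setT < +oo)%E -> (m2 setT < +oo)%E -> bmeas h -> (forall x, 0 <= h x) ->
  \int[measure_add m1 m2]_x h x = \int[m1]_x h x + \int[m2]_x h x.
Proof.
move=> m1fin m2fin bh h0; have [mh _] := bh.
rewrite /Rintegral ge0_integral_measure_add//; last 2 first.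
- by move=> x _; rewrite lee_fin.
- exact/measurable_EFinP.
by rewrite fineD//; apply: integrable_fin_num => //; exact: bmeas_integrable.
Qed.

(** The sum counts the positive multiples of [delta] up to [t], so [t] is being rounded down to the
    grid. *)
Lemma layer_cake (R : realDomainType) (N : nat) (delta t : R) :
  0 < delta -> 0 <= t <= N%:R * delta ->
  `|t - delta * \sum_(k < N) (k.+1%:R * delta <= t)%R%:R| <= delta.
Proof.
move=> delta0; elim: N => [|N IHN] /=.
  by rewrite mul0r big_ord0 mulr0 subr0 => tE; rewrite ler_norml; apply/andP; lra.
move=> /andP[t0 tN]; rewrite big_ord_recr /=.
have [tlt|tge] := ltP t (N%:R * delta).
  rewrite (_ : (_ <= t) = false) ?addr0; first by apply: IHN; rewrite t0 ltW.
  by apply/negbTE; rewrite -ltNge (lt_trans tlt)// ltr_pM2r// ltr_nat.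
rewrite (eq_bigr (fun=> 1)) => [|k _]; last first.
  by rewrite (le_trans _ tge)// ler_pM2r// ler_nat.
rewrite sumr_const card_ord ler_norml; apply/andP.
rewrite -natr1 mulrDl mul1r in tN *.
by case: (leP (N%:R * delta + delta) t) => h /=; lra.
Qed.

Section probability_eq.
Context d (X : measurableType d) (R : realType) (dist : X -> X -> R).
Hypothesis dist_metric : is_metric dist.
Hypothesis dist_compact : dcompact dist.
Hypothesis dist_borel : borel_of dist.

Let lip_bmeas := lipschitz1_bmeas dist_metric dist_compact dist_borel.

Lemma probability_eq_lipschitz (mu nu : probability X R) :
  (forall F, lipschitz_dist dist F -> \int[mu]_x F x = \int[nu]_x F x) ->
  forall A, measurable A -> mu A = nu A.
Proof.
move=> munu A mA.
have mufin := probability_lty mu; have nufin := probability_lty nu.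
rewrite -(fineK (fin_num_measure mu _ mA)) -(fineK (fin_num_measure nu _ mA)).
congr EFin; apply/eqP; rewrite -subr_eq0 -normr_le0; apply/ler_addgt0Pr => e e0.
rewrite add0r.
(* Approximating in L^1 of the sum makes a single [g] serve both measures. *)
have qfin : (measure_add mu nu setT < +oo)%E.
  by rewrite measure_addE; exact: lte_add_pinfty.
have [_ /(_ _ e0)[g [lg g01 gA]]] :=
  lipschitz_dense dist_metric dist_compact dist_borel qfin mA.
have bg := lip_bmeas lg; have bA := bmeas_indic R mA.
have bAg : bmeas (fun x => \1_A x - g x) by exact: bmeasB.
rewrite -!bint_indic//; apply: le_trans gA.
rewrite bint_measure_add//; last by exact: bmeas_norm.
have -> : \int[mu]_x \1_A x - \int[nu]_x \1_A x =
    \int[mu]_x (\1_A x - g x) - \int[nu]_x (\1_A x - g x).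
  by rewrite !bintB// (munu g lg); ring.
apply: le_trans (ler_normB _ _) _; apply: lerD.
  by apply: le_normr_Rintegral => //; exact: bmeas_integrable.
by apply: le_normr_Rintegral => //; exact: bmeas_integrable.
Qed.

(** The bound on [g] does not depend on [e]; this keeps the exponentials under control in
    [bmeas_dual]. *)
Lemma bmeas_lipschitz_dense (q : {measure set X -> \bar R}) (f : X -> R) M (e : R) :
  (q setT < +oo)%E -> measurable_fun setT f -> (forall x, `|f x| <= M) -> 0 < e ->
  exists g, [/\ lipschitz_dist dist g, forall x, `|g x| <= M + 1 & \int[q]_x `|f x - g x| <= e].
Proof.
move=> qfin mf fM e0.
have M0 : 0 <= M by exact: le_trans (fM point).
pose Q := fine (q setT); have Q0 : 0 <= Q by exact: fine_ge0.
have M1 : 0 < 2 * (M + 1) by lra.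
(* [f + (M + 1)] is cut into [N + 1] layers of height [delta]. Rounding costs [delta * Q].
   Approximating the [N + 1] level sets, each up to [1 / (N + 1)], costs [delta] more. The constant
   [c] makes the total at most [e]. *)
pose c := 2 * (M + 1) * (Q + 1).
have [N cN] : exists N : nat, c / e <= N.+1%:R.
  by exists (Num.truncn (c / e)); rewrite ltW// truncnS_gt.
have N0 : (0 : R) < N.+1%:R by rewrite ltr0n.
pose delta : R := 2 * (M + 1) / N.+1%:R.
have delta0 : 0 < delta by rewrite divr_gt0.
have deltaN : N.+1%:R * delta = 2 * (M + 1) by rewrite /delta mulrCA divff ?mulr1 ?gt_eqF.
have deltaQ : delta * (Q + 1) <= e.
  by move: cN; rewrite ler_pdivrMr// /delta mulrAC ler_pdivrMr// mulrC.
pose A k := [set x | k.+1%:R * delta <= f x + (M + 1)].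
have mA k : measurable (A k).
  rewrite -[X in measurable X]setTI.
  rewrite (_ : A k = (fun x => f x + (M + 1)) @^-1` `[k.+1%:R * delta, +oo[%classic).
    by apply: measurable_funD => //; exact: measurable_itv.
  by apply/seteqP; split=> x /=; rewrite in_itv/= andbT.
have eta0 : 0 < N.+1%:R^-1 :> R by rewrite invr_gt0.
have /choice[h hP] k : exists g : X -> R, [/\ lipschitz_dist dist g,
    forall x, 0 <= g x <= 1 & \int[q]_x `|\1_(A k) x - g x| <= N.+1%:R^-1].
  by have [_ /(_ _ eta0)] := lipschitz_dense dist_metric dist_compact dist_borel qfin (mA k).
have lh k : lipschitz_dist dist (h k) by case: (hP k).
have h01 k x : 0 <= h k x <= 1 by case: (hP k).
pose s (u : nat -> X -> R) x := delta * (\sum_(k < N.+1) u k x) - (M + 1).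
exists (s h); split.
- apply: lipschitzB; last exact: lipschitz_cst.
  by apply: lipschitzZ; exact: lipschitz_sum.
- move=> x; rewrite /s.
  have : delta * (\sum_(k < N.+1) h k x) <= 2 * (M + 1).
    rewrite -deltaN mulrC ler_wpM2r ?(ltW delta0)//.
    have -> : N.+1%:R = \sum_(k < N.+1) (1 : R) by rewrite sumr_const card_ord.
    by apply: ler_sum => k _; case/andP: (h01 k x).
  have : 0 <= delta * (\sum_(k < N.+1) h k x).
    by rewrite mulr_ge0 ?(ltW delta0)// sumr_ge0// => k _; case/andP: (h01 k x).
  by rewrite ler_norml => ? ?; apply/andP; lra.
have bh k : bmeas (h k) by exact: lip_bmeas.
have bA k : bmeas (\1_(A k) : X -> R) by exact: bmeas_indic.
have bf : bmeas f by split=> //; exists M.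
have bAh k : bmeas (fun x => `|\1_(A k) x - h k x|).
  by apply: bmeas_norm; exact: bmeasB.
have bSh : bmeas (fun x => \sum_(k < N.+1) h k x) by exact: bmeas_sum.
have bS : bmeas (s h).
  by apply: bmeasB; [exact: bmeasZ|exact: bmeas_cst].
apply: le_trans (_ : _ <= \int[q]_x (delta +
    delta * \sum_(k < N.+1) `|\1_(A k) x - h k x|)) _.
  apply: le_bint => //.
  - by apply: bmeas_norm; exact: bmeasB.
  - by apply: bmeasD; [exact: bmeas_cst|apply: bmeasZ; exact: bmeas_sum].
  move=> x; have fMx : 0 <= f x + (M + 1) <= N.+1%:R * delta.
    by rewrite deltaN; have := fM x; rewrite ler_norml; lra.
  have := layer_cake delta0 fMx.
  have -> : f x - s h x = (f x + (M + 1) -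
        delta * \sum_(k < N.+1) (k.+1%:R * delta <= f x + (M + 1))%R%:R)
      + delta * \sum_(k < N.+1) (\1_(A k) x - h k x).
    rewrite /s sumrB; under [in RHS]eq_bigr => k _.
      rewrite (_ : _%:R = \1_(A k) x); first over.
      by rewrite indicE; congr ((nat_of_bool _)%:R); apply/idP/idP => [?|/set_mem//]; exact: mem_set.
    by ring.
  move=> lc; apply: le_trans (ler_normD _ _) _; apply: lerD => //.
  rewrite normrM ger0_norm ?(ltW delta0)// ler_wpM2l ?(ltW delta0)//.
  exact: ler_norm_sum.
rewrite bintD//; [|exact: bmeas_cst|by apply: bmeasZ; exact: bmeas_sum].
rewrite bint_cst bintZ//; last exact: bmeas_sum.
rewrite bint_sum//; apply: le_trans deltaQ; rewrite mulrDr mulr1 lerD2l.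
rewrite -[leRHS]mulr1 ler_wpM2l ?(ltW delta0)//.
have -> : (1 : R) = \sum_(k < N.+1) N.+1%:R^-1.
  by rewrite sumr_const card_ord -[RHS]mulr_natl divff ?gt_eqF.
by apply: ler_sum => k _; case: (hP k).
Qed.

End probability_eq.

(** As with [measure_fun], a convertible copy of [m], here to carry the finite-measure structure
    that the Radon-Nikodym theorem expects. *)
Definition finite_fun d (T : measurableType d) (R : realType)
  (m : {measure set T -> \bar R}) & (m setT < +oo)%E : set T -> \bar R := m.

Section finite_fun.
Context d (T : measurableType d) (R : realType).
Variables (m : {measure set T -> \bar R}) (mfin : (m setT < +oo)%E).

Let finite_fun_fin : fin_num_fun (finite_fun mfin).
Proof. by apply: lty_fin_num_fun. Qed.

HB.instance Definition _ := isMeasure.Build d T R (finite_fun mfin)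
  (measure0 m) (measure_ge0 m) (@measure_semi_sigma_additive _ _ _ m).
HB.instance Definition _ := Measure_isFinite.Build d T R (finite_fun mfin) finite_fun_fin.

End finite_fun.

Lemma radon_nikodym_density d (T : measurableType d) (R : realType)
    (m : {measure set T -> \bar R}) (nu : probability T R) :
  (m setT < +oo)%E -> (forall A, measurable A -> m A = 0%E -> nu A = 0%E) ->
  exists rho : T -> R, [/\ measurable_fun setT rho, (forall x, 0 <= rho x) &
    forall A, measurable A -> nu A = (\int[m]_(x in A) (rho x)%:E)%E].
Proof.
move=> mfin numu.
have numu' : nu `<< finite_fun mfin.
  by move=> A mA0 B mB BA; apply: numu => //; exact: mA0.
pose f := Radon_Nikodym_SigmaFinite.f nu (finite_fun mfin).
have f_ge0 : forall x, (0 <= f x)%E by exact: Radon_Nikodym_SigmaFinite.f_ge0.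
have f_fin : forall x, f x \is a fin_num by exact: Radon_Nikodym_SigmaFinite.f_fin_num.
exists (fine \o f); split.
- apply: measurableT_comp => //.
  exact: measurable_int (Radon_Nikodym_SigmaFinite.f_integrable numu').
- by move=> x; exact: fine_ge0.
- move=> A mA; rewrite (Radon_Nikodym_SigmaFinite.f_integral numu')//.
  by apply: eq_integral => x _; rewrite /= fineK.
Qed.

(** With [c] the clamp of [t] to the interval from [1 / N] to [N], [(1 + ln c) * t - c] is the dual
    integrand for the test value [1 + ln c]. The constant 2 makes it nonnegative for every [N], as
    required by Fatou's lemma. *)
Lemma xlnx_clamp_ge (R : realType) (t N : R) : 0 <= t -> 1 <= N ->
  0 <= (1 + ln (Num.max N^-1 (Num.min t N))) * t - Num.max N^-1 (Num.min t N) + 2.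
Proof.
move=> t0 N1; have N0 : 0 < N by lra.
have NV : N^-1 <= 1 by rewrite invf_le1.
have lnN0 : 0 <= ln N by exact: ln_ge0.
have [tN|Nt] := leP t N; last first.
  rewrite max_r; last by lra.
  have : 0 <= ln N * t by exact: mulr_ge0.
  lra.
have [Nt|Nt] := leP N^-1 t.
  by have := xlnx_dual 0 t0; rewrite mul0r sub0r; have : expR (-1) <= 1 :> R;
    [rewrite -[leRHS]expR0 ler_expR; lra|lra].
rewrite lnV ?posrE//.
have lnN : ln N <= N - 1.
  by have := expR_ge1Dx (ln N); rewrite lnK ?posrE//; lra.
have : ln N * t <= (N - 1) * t by rewrite ler_wpM2r.
have : N * t <= 1.
  by move: Nt; rewrite -(ltr_pM2l N0) divff ?gt_eqF//; exact: ltW.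
lra.
Qed.

(** * Entropy from its dual formulation *)

Section Ent_from_dual.
Context d (X : measurableType d) (R : realType) (dist : X -> X -> R).
Hypothesis dist_metric : is_metric dist.
Hypothesis dist_compact : dcompact dist.
Hypothesis dist_borel : borel_of dist.
Variables (m : {measure set X -> \bar R}) (nu : probability X R) (E : R).
Hypothesis mfin : (m setT < +oo)%E.
Hypothesis dual : forall f, lipschitz_dist dist f ->
  \int[nu]_x f x - \int[m]_x expR (f x - 1) <= E.

Let lip_bmeas := lipschitz1_bmeas dist_metric dist_compact dist_borel.

Lemma bmeas_dual f : bmeas f -> \int[nu]_x f x - \int[m]_x expR (f x - 1) <= E.
Proof.
move=> bf; have [mf [M fM]] := bf; apply/ler_addgt0Pr => e e0.
have M0 : 0 <= M by exact: le_trans (fM point).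
have nufin := probability_lty nu.
have qfin : (measure_add nu m setT < +oo)%E.
  by rewrite measure_addE; exact: lte_add_pinfty.
(* Replacing [f] by [g] costs the L^1 distance under [nu], and at most [expR M] times that distance
   under [m], because [g - 1 <= M]. *)
pose C := 1 + expR M; have C0 : 0 < C by rewrite /C; have := expR_ge0 M; lra.
have eC : 0 < e / C by rewrite divr_gt0.
have [g [lg gM]] := bmeas_lipschitz_dense dist_metric dist_compact dist_borel qfin mf fM eC.
have bg := lip_bmeas lg.
have bfg : bmeas (fun x => `|f x - g x|) by apply: bmeas_norm; exact: bmeasB.
have bexp h : bmeas h -> bmeas (fun x => expR (h x - 1)).
  by move=> bh; apply: bmeas_expR; apply: bmeasB => //; exact: bmeas_cst.
rewrite bint_measure_add// ler_pdivlMr// => gC.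
have Inu : \int[nu]_x f x - \int[nu]_x g x <= \int[nu]_x `|f x - g x|.
  by rewrite -bintB//; apply: le_bint => //; [exact: bmeasB|move=> x; exact: ler_norm].
have Im : \int[m]_x expR (g x - 1) - \int[m]_x expR (f x - 1) <=
    expR M * \int[m]_x `|f x - g x|.
  rewrite -bintB//; [|exact: bexp..]; rewrite -bintZ//; apply: le_bint => //.
  - by apply: bmeasB; exact: bexp.
  - exact: bmeasZ.
  move=> x; have := expR_tangent (g x - 1) (f x - 1).
  have := gM x; rewrite ler_norml => gx.
  have : expR (g x - 1) <= expR M by rewrite ler_expR; lra.
  have := expR_ge0 (g x - 1); have := ler_norm (- (f x - g x)); rewrite normrN.
  have := normr_ge0 (f x - g x).
  set u := expR (g x - 1); set v := `|_| => v0 uv u0 uM tang.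
  have : u * (g x - f x) <= u * v by rewrite ler_wpM2l//; lra.
  have : u * v <= expR M * v by rewrite ler_wpM2r.
  lra.
have := dual lg.
have : 0 <= \int[nu]_x `|f x - g x| by exact: bint_ge0.
have : 0 <= \int[m]_x `|f x - g x| by exact: bint_ge0.
have := expR_ge0 M; move: gC Inu Im; rewrite /C; set a := \int[nu]_x `|_|; set b := \int[m]_x `|_|.
move=> gC Inu Im M1 b0 a0; have : 0 <= expR M * a by exact: mulr_ge0.
lra.
Qed.

(** On the test functions [N * 1_A] with [m A = 0], the exponential term stays below the total mass
    of [m] while the other term is [N * nu A]. *)
Lemma dual_dominates A : measurable A -> m A = 0%E -> nu A = 0%E.
Proof.
move=> mA mA0; have nufin := probability_lty nu.
have bA := bmeas_indic R mA.
suff : fine (nu A) <= 0.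
  move=> nA0; rewrite -(fineK (fin_num_measure nu _ mA)); congr EFin.
  by apply/eqP; rewrite eq_le nA0 fine_ge0.
rewrite leNgt; apply/negP => nA0.
set Q := fine (m setT).
have key N : 0 <= N -> N * fine (nu A) <= E + Q.
  move=> N0; have bN : bmeas (fun x => N * \1_A x) by exact: bmeasZ.
  have := bmeas_dual bN; rewrite bintZ// bint_indic//.
  suff : \int[m]_x expR (N * \1_A x - 1) <= Q by lra.
  apply: le_trans (_ : _ <= \int[m]_x (1 + expR N * \1_A x)) _.
    apply: le_bint => //.
    - by apply: bmeas_expR; apply: bmeasB => //; exact: bmeas_cst.
    - by apply: bmeasD; [exact: bmeas_cst|exact: bmeasZ].
    move=> x; rewrite indicE; case: (x \in A) => /=.
      rewrite !mulr1; have : expR (N - 1) <= expR N by rewrite ler_expR; lra.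
      by move=> ?; lra.
    by rewrite !mulr0 addr0 sub0r -[leRHS]expR0 ler_expR lerN10.
  rewrite bintD//; [|exact: bmeas_cst|exact: bmeasZ].
  by rewrite bint_cst mul1r bintZ// bint_indic// mA0 mulr0 addr0.
have := key ((`|E| + Q + 1) / fine (nu A)) _; rewrite divfK ?gt_eqF//.
have Q0 : 0 <= Q by exact: fine_ge0.
move=> /(_ _)/wrap[]; first by rewrite divr_ge0// ?ltW//; have := normr_ge0 E; lra.
by have := ler_norm E; lra.
Qed.

Lemma Ent_le_dual : (Ent m nu <= E%:E)%E.
Proof.
have [rho [mrho rho0 nurho]] := radon_nikodym_density mfin dual_dominates.
pose N n : R := n.+1%:R.
have N1 n : 1 <= N n by rewrite ler1n.
have N0 n : 0 < N n by rewrite ltr0n.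
(* The optimal test function would be [1 + ln rho]; clamping [rho] makes it bounded. *)
pose c n x := Num.max (N n)^-1 (Num.min (rho x) (N n)).
have c0 n x : 0 < c n x by rewrite lt_max invr_gt0 N0.
have cN n x : c n x <= N n.
  by rewrite ge_max ge_min lexx orbT andbT (le_trans _ (N1 n))// invf_le1.
have bc n : bmeas (c n).
  split; last by exists (N n) => x; rewrite ger0_norm// ltW.
  apply: measurable_maxr => //; apply: measurable_minr => //.
have bf n : bmeas (fun x => 1 + ln (c n x)).
  apply: bmeasD; first exact: bmeas_cst.
  split; first by apply: measurableT_comp; [exact: measurable_ln|case: (bc n)].
  exists (ln (N n)) => x; rewrite ler_norml -lnV ?posrE//.
  rewrite !ler_ln ?posrE ?invr_gt0// cN andbT.
  by rewrite le_max lexx.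
have bfr n := bmeas_density_integrable mrho rho0 nurho (bf n).
pose g n x := (1 + ln (c n x)) * rho x - c n x + 2.
have ifc n : m.-integrable setT (fun x => ((1 + ln (c n x)) * rho x - c n x)%:E).
  under eq_fun do rewrite EFinB.
  by apply: integrableB => //; exact: bmeas_integrable.
have ig n : m.-integrable setT (EFin \o g n).
  rewrite (_ : EFin \o g n =
    (fun x => ((1 + ln (c n x)) * rho x - c n x)%:E) \+ cst 2%:E)%E//.
  by apply: integrableD => //; apply: bmeas_integrable => //; exact: bmeas_cst.
have g0 n x : 0 <= g n x by exact: xlnx_clamp_ge.
set Q := fine (m setT).
have gE n : (\int[m]_x (g n x)%:E <= (E + 2 * Q)%:E)%E.
  have := bmeas_dual (bf n); rewrite (bint_density mrho rho0 nurho (bf n)).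
  under [X in _ - X]eq_Rintegral => x _.
    rewrite addrAC subrr add0r lnK ?posrE//; over.
  rewrite -RintegralB//; [|exact: bfr|exact: bmeas_integrable].
  move=> gE; rewrite -(fineK (integrable_fin_num measurableT (ig n))) lee_fin.
  rewrite -[leLHS]/(\int[m]_x g n x) /g RintegralD//.
  - by rewrite bint_cst -/Q; lra.
  - exact: ifc.
  - by apply: bmeas_integrable => //; exact: bmeas_cst.
pose h x := rho x * ln (rho x) + 2.
have gh x : (g n x)%:E @[n --> \oo] --> (h x)%:E.
  apply: cvg_EFin; first exact: nearW.
  (* Where [rho x = 0] the clamp is [1 / (n + 1)], which tends to 0; elsewhere it is eventually
     equal to [rho x]. *)
  rewrite /g /h /c; have := rho0 x; rewrite le_eqVlt => /predU1P[<-|rx0].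
    under eq_fun => k.
      rewrite mulr0 max_l; last by rewrite min_l ?invr_ge0// ltW.
      over.
    rewrite mul0r (_ : (0 + 2 : R) = 0 - 0 + 2); last by rewrite subr0.
    apply: cvgD; last exact: cvg_cst.
    apply: cvgB; first exact: cvg_cst.
    by have := @cvg_harmonic R.
  apply: cvg_near_cst.
  have /cvgr_lt/(_ _ rx0) := @cvg_harmonic R.
  have [k kx] : exists k : nat, rho x <= k%:R.
    by exists (Num.truncn (rho x)).+1; rewrite ltW// truncnS_gt.
  move=> nx; near=> n; rewrite /comp/=.
  have -> : Num.max (N n)^-1 (Num.min (rho x) (N n)) = rho x.
    rewrite min_l; last first.
      apply: le_trans kx _; rewrite /N ler_nat; near: n.
      by exists k => // n /= kn; exact: leq_trans kn _.
    by rewrite max_r// ltW//; near: n.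
  by ring.
have mh : measurable_fun setT h.
  apply: measurable_funD => //; apply: measurable_funM => //.
  exact: measurableT_comp.
have h0 x : 0 <= h x.
  by have := xlnx_dual 0 (rho0 x); rewrite /h mul0r sub0r;
    have : expR (-1) <= 1 :> R; [rewrite -[leRHS]expR0 ler_expR; lra|lra].
have hE : (\int[m]_x (h x)%:E <= (E + 2 * Q)%:E)%E.
  have := @fatou _ _ _ m setT measurableT (fun n x => (g n x)%:E) _ _.
  move=> /(_ (fun n => measurable_int _ (ig n)) (fun n x _ => g0 n x)).
  under eq_integral => x _ do rewrite (cvg_limn_einf_sup (gh x)).1.
  move=> /le_trans; apply; rewrite limn_einf_lim; apply: lime_le.
    exact: is_cvg_einfs.
  apply: nearW => n; apply: le_trans (gE n).
  by apply: ereal_inf_lbound; exists n => /=.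
(* Only now that [h] is known to be integrable can the constant 2 be subtracted back. *)
have ih : m.-integrable setT (EFin \o h).
  apply/integrableP; split; first exact/measurable_EFinP.
  under eq_integral => x _ do rewrite /= ger0_norm//.
  exact: le_lt_trans hE (ltry _).
apply: ge_ereal_inf; exists (\int[m]_x (rho x * ln (rho x))%:E)%E; first by exists rho.
have -> : (\int[m]_x (rho x * ln (rho x))%:E = \int[m]_x ((h x)%:E - 2%:E))%E.
  by apply: eq_integral => x _; rewrite /h -EFinB addrK.
rewrite integralB//; last by apply: bmeas_integrable => //; exact: bmeas_cst.
rewrite integral_cst// -(fineK (_ : m setT \is a fin_num)); last by rewrite ge0_fin_numE.
by rewrite -/Q -EFinM leeBlDr// -EFinD.
Unshelve. all: by end_near. Qed.

End Ent_from_dual.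

(** * Discretization and recovery sequences *)

Definition partition_of_unity (R : realType) (X : Type) (dist : X -> X -> R)
    (delta : R) (N : nat) (c : 'I_N -> X) (h : 'I_N -> X -> R) :=
  [/\ forall l, lipschitz_dist dist (h l), forall l x, 0 <= h l x,
      forall x, \sum_l h l x = 1 &
      forall l x, h l x != 0 -> dist (c l) x <= delta].

(** Tents of height [delta] over a [delta / 2]-net have sum at least [delta / 2], so dividing by the
    sum keeps them Lipschitz. *)
Lemma partition_of_unity_exists d (X : measurableType d) (R : realType)
    (dist : X -> X -> R) (delta : R) :
  is_metric dist -> dcompact dist -> borel_of dist -> 0 < delta ->
  exists N (c : 'I_N -> X) h, partition_of_unity dist delta c h.
Proof.
move=> dist_metric dist_compact dist_borel delta0.
have distC : forall x y, dist x y = dist y x by case: dist_metric.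
have distD : forall x y z, dist x z <= dist x y + dist y z by case: dist_metric.
have d0 : forall x y, 0 <= dist x y by exact: dist_ge0.
have delta20 : 0 < delta / 2 by rewrite divr_gt0.
have [N [c cP]] := finite_ball_cover dist_metric dist_compact delta20.
pose g l x := Num.max 0 (delta - dist (c l) x).
pose G x := \sum_l g l x.
have lg l : lipschitz_dist dist (g l).
  apply: lipschitz_max => //; first exact: lipschitz_cst.
  exists 1 => // x y; rewrite mul1r ler_norml; apply/andP.
  by have := distD (c l) x y; have := distD (c l) y x; rewrite (distC y x) => ? ?; lra.
have lG : lipschitz_dist dist G by exact: lipschitz_sum.
have g0 l x : 0 <= g l x by rewrite le_max lexx.
have Gge x : delta / 2 <= G x.
  have [i ix] := cP x; rewrite /G (bigD1 i)//= -[leLHS]addr0; apply: lerD.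
    by rewrite /g le_max; apply/orP; right; lra.
  exact: sumr_ge0.
have G0 x : 0 < G x by exact: lt_le_trans (Gge x).
have lip_bm := lipschitz1_bmeas dist_metric dist_compact dist_borel.
have lGV : lipschitz_dist dist (fun x => (G x)^-1) by exact: lipschitzV lG delta20 Gge.
exists N, c, (fun l x => g l x * (G x)^-1); split.
- move=> l; have [_ [M1 g1]] := lip_bm _ (lg l); have [_ [M2 g2]] := lip_bm _ lGV.
  apply: (lipschitzM (lg l) lGV _ _ g1 g2).
    exact: le_trans (g1 point).
  exact: le_trans (g2 point).
- by move=> l x; rewrite mulr_ge0// invr_ge0 ltW.
- by move=> x; rewrite -mulr_suml -/(G x) divff// gt_eqF.
- move=> l x; rewrite mulf_eq0 negb_or => /andP[+ _]; rewrite /g.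
  by case: (leP 0 (delta - dist (c l) x)) => [|_]; rewrite ?eqxx// subr_ge0.
Qed.

Lemma expR_jensen (R : realType) (I : finType) (h a : I -> R) :
  (forall i, 0 <= h i) -> \sum_i h i = 1 ->
  expR (\sum_i h i * a i) <= \sum_i h i * expR (a i).
Proof.
move=> h0 h1; set A := \sum_i h i * a i.
have -> : expR A = \sum_i h i * (expR A * (1 + a i - A)).
  transitivity (expR A * \sum_i (h i * (1 - A) + h i * a i)).
    by rewrite big_split/= -mulr_suml h1 mul1r -/A subrK mulr1.
  by rewrite mulr_sumr; apply: eq_bigr => i _; ring.
by apply: ler_sum => i _; rewrite ler_wpM2l// expR_tangent.
Qed.

(** Young's inequality with the common slope [1 + ln r] is the tangent line of [t ln t] at the mean
    [r]; for [r = 0] every product [h i * s i] vanishes. *)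
Lemma xlnx_jensen (R : realType) (I : finType) (h s : I -> R) :
  (forall i, 0 <= h i) -> \sum_i h i = 1 -> (forall i, 0 <= s i) ->
  (\sum_i h i * s i) * ln (\sum_i h i * s i) <= \sum_i h i * (s i * ln (s i)).
Proof.
move=> h0 h1 s0; set r := \sum_i h i * s i.
have r0 : 0 <= r by apply: sumr_ge0 => i _; exact: mulr_ge0.
have -> : r * ln r = \sum_i h i * ((1 + ln r) * s i - r).
  transitivity ((1 + ln r) * r - r * \sum_i h i); first by rewrite h1; ring.
  rewrite {1}/r !mulr_sumr -sumrB; apply: eq_bigr => i _; ring.
apply: ler_sum => i _.
have [r00|rn0] := eqVneq r 0.
  have /psumr_eq0P : \sum_i h i * s i = 0 by [].
  move=> /(_ (fun i _ => mulr_ge0 (h0 i) (s0 i)))/(_ i isT) hs0.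
  by rewrite r00 subr0 mulrCA hs0 mulr0 mulrA hs0 mul0r.
rewrite ler_wpM2l// lerBlDr.
have := xlnx_dual (1 + ln r) (s0 i).
by rewrite addrAC subrr add0r lnK// posrE lt_neqAle eq_sym rn0.
Qed.

Section discrete_entropy.
Context d (X : measurableType d) (R : realType) (dist : X -> X -> R).
Hypothesis dist_metric : is_metric dist.
Hypothesis dist_compact : dcompact dist.
Hypothesis dist_borel : borel_of dist.
Variables (delta : R) (N : nat) (c : 'I_N -> X) (h : 'I_N -> X -> R).
Hypothesis PU : partition_of_unity dist delta c h.
Variables (m : {measure set X -> \bar R}) (mu : probability X R).
Hypothesis mfin : (m setT < +oo)%E.

Let bh l : bmeas (h l).
Proof. by apply: (lipschitz1_bmeas dist_metric dist_compact dist_borel); case: PU. Qed.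

(* [Ent_dual] for [f = sum_l h_l (1 + ln s_l)]. *)
Lemma discrete_dual (s : 'I_N -> R) : (forall l, 0 < s l) ->
  ((\sum_l (1 + ln (s l)) * \int[mu]_x h l x - \sum_l s l * \int[m]_x h l x)%:E
     <= Ent m mu)%E.
Proof.
move=> s0; have [_ h0 h1 _] := PU; have mufin := probability_lty mu.
pose f x := \sum_l h l x * (1 + ln (s l)).
have bhs (a : 'I_N -> R) l : bmeas (fun x => h l x * a l).
  by apply: bmeasM => //; exact: bmeas_cst.
have bf : bmeas f by apply: bmeas_sum => l; exact: (bhs (fun l => 1 + ln (s l))).
apply: le_trans (Ent_dual mfin mu bf); rewrite lee_fin; apply: lerB.
  rewrite /f bint_sum//; last by move=> l; exact: (bhs (fun l => 1 + ln (s l))).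
  apply: ler_sum => l _; under [leRHS]eq_Rintegral do rewrite mulrC.
  by rewrite bintZ.
apply: (@le_trans _ _ (\int[m]_x \sum_l h l x * s l)).
  apply: le_bint => //.
  - by apply: bmeas_expR; apply: bmeasB => //; exact: bmeas_cst.
  - by apply: bmeas_sum => l; exact: bhs.
  move=> x; have -> : f x - 1 = \sum_l h l x * ln (s l).
    rewrite /f -[X in _ - X](h1 x) -sumrB; apply: eq_bigr => l _; ring.
  apply: le_trans (expR_jensen _ _ _) _ => //.
  by apply: ler_sum => l _; rewrite lnK// posrE.
rewrite bint_sum//; [|by move=> l; exact: bhs..].
apply: ler_sum => l _; under [leLHS]eq_Rintegral do rewrite mulrC.
by rewrite bintZ.
Qed.

(** If [h l] has no mass under [m], raising [s l] alone costs nothing in [discrete_dual], while the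
    gain grows linearly in [ln (s l)]; finite entropy forbids this. *)
Lemma discrete_dominates : (Ent m mu < +oo)%E ->
  forall l, \int[m]_x h l x = 0 -> \int[mu]_x h l x = 0.
Proof.
move=> Efin l bl0; have [_ h0 _ _] := PU.
apply/eqP; rewrite eq_le bint_ge0// andbT leNgt; apply/negP => cl0.
have key (t : R) : 0 <= t -> ((t * \int[mu]_x h l x - \sum_l \int[m]_x h l x)%:E <= Ent m mu)%E.
  move=> t0; pose s i := if i == l then expR t else 1.
  have s0 i : 0 < s i by rewrite /s; case: ifP => _ //; exact: expR_gt0.
  apply: le_trans (discrete_dual s0); rewrite lee_fin; apply: lerB.
    rewrite [leRHS](bigD1 l)//= /s eqxx expRK -[leLHS]addr0; apply: lerD.
      by rewrite ler_wpM2r ?bint_ge0//; lra.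
    apply: sumr_ge0 => i il; rewrite (negbTE il) ln1 addr0 mul1r.
    exact: bint_ge0.
  apply: ler_sum => i _; rewrite /s; case: eqP => [->|_]; last by rewrite mul1r.
  by rewrite bl0 mulr0.
set S := \sum_l _ in key.
case: (Ent m mu) Efin key => [E| |] // _ key; last first.
  by have := key 0 (lexx _); rewrite leeNy_eq.
have := key ((`|E| + `|S| + 1) / \int[mu]_x h l x).
rewrite divfK ?gt_eqF// lee_fin => /(_ _)/wrap[].
  by rewrite divr_ge0 ?ltW//; have := normr_ge0 E; have := normr_ge0 S; lra.
by have := ler_norm E; have := ler_norm S; have := normr_ge0 S; lra.
Qed.

(** The optimal [s l = C l / B l] is not positive where [C l = 0]. There it is replaced by a small
    [sigma], at a total cost of at most [sigma * S < tau]. *)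
Lemma discrete_entropy_le (tau : R) : 0 < tau -> (Ent m mu < +oo)%E ->
  ((\sum_l \int[mu]_x h l x * ln (\int[mu]_x h l x / \int[m]_x h l x))%:E
     <= Ent m mu + tau%:E)%E.
Proof.
move=> tau0 Efin; have [_ h0 _ _] := PU.
set C := fun l => \int[mu]_x h l x; set B := fun l => \int[m]_x h l x.
have C0 l : 0 <= C l by exact: bint_ge0.
have B0 l : 0 <= B l by exact: bint_ge0.
pose S := \sum_l B l; have S0 : 0 <= S by exact: sumr_ge0.
pose sigma := tau / (S + 1).
have sigma0 : 0 < sigma by rewrite divr_gt0//; lra.
pose s l := if C l == 0 then sigma else C l / B l.
have CB l : C l != 0 -> 0 < B l.
  move=> Cl; rewrite lt_neqAle B0 andbT; apply: contra Cl => /eqP Bl.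
  exact/eqP/(discrete_dominates Efin).
have s0 l : 0 < s l.
  rewrite /s; case: eqVneq => // Cl; rewrite divr_gt0 ?CB//.
  by rewrite lt_neqAle eq_sym Cl C0.
rewrite -leeBlDr//; apply: le_trans (discrete_dual s0).
rewrite -EFinB lee_fin.
suff : \sum_l C l * ln (C l / B l) - tau <= \sum_l (1 + ln (s l)) * C l - \sum_l s l * B l.
  by [].
have <- : \sum_l sigma * B l + sigma = tau.
  rewrite -mulr_sumr -[X in _ + X]mulr1 -mulrDr -/S /sigma divfK//.
  by rewrite gt_eqF//; lra.
rewrite opprD addrA -!sumrB -[leRHS]subr0; apply: lerB; last exact: ltW.
apply: ler_sum => l _; rewrite /s; case: eqVneq => [->|Cl].
  by rewrite mul0r mulr0.
rewrite divfK ?gt_eqF ?CB//.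
by have := mulr_ge0 (ltW sigma0) (B0 l); lra.
Qed.

End discrete_entropy.

(** * Mixtures and marginals of couplings *)

Lemma mixture_bint d (T : measurableType d) (R : realType) (I : finType) (q : I -> R)
    (P : I -> probability T R) : (forall i, 0 <= q i) -> \sum_i q i = 1 ->
  exists Q : probability T R,
    (forall A, Q A = (\sum_i (q i)%:E * P i A)%E) /\
    (forall f : T -> R, bmeas f -> \int[Q]_x f x = \sum_i q i * \int[P i]_x f x).
Proof.
move=> q0 q1; have [Q [QA QI]] := mixture_probability P q0 q1.
exists Q; split=> // f bf; have [mf [M fM]] := bf.
have bM : bmeas (fun _ : T => M) by exact: bmeas_cst.
have fM0 x : 0 <= f x + M by have := fM x; rewrite ler_norml; lra.
have bfM : bmeas (fun x => f x + M) by exact: bmeasD.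
have Qfin := probability_lty Q.
have Pfin i : ((P i : {measure set T -> \bar R}) setT < +oo)%E by exact: probability_lty.
have cM (m : probability T R) : \int[m]_x M = M.
  by rewrite bint_cst [X in fine X](@probability_setT _ _ _ m) mulr1.
have : \int[Q]_x (f x + M) = \sum_i q i * \int[P i]_x (f x + M).
  apply: EFin_inj; rewrite -bint_EFin// QI; last 2 first.
  - by apply/measurable_EFinP; case: bfM.
  - by move=> x; rewrite lee_fin.
  by rewrite -sumEFin; apply: eq_bigr => i _; rewrite EFinM bint_EFin.
rewrite bintD// cM (eq_bigr (fun i => q i * \int[P i]_x f x + q i * M)).
  by rewrite big_split/= -mulr_suml q1 mul1r => /addIr.
by move=> i _; rewrite bintD// cM mulrDr.
Qed.

Section couplings.
Context d (X : measurableType d) (R : realType).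
Variables (mu nu : probability X R) (pi : probability (X * X)%type R).
Hypothesis munu : coupling mu nu pi.

Lemma coupling_fst F : bmeas F -> \int[pi]_z F z.1 = \int[mu]_x F x.
Proof.
have [Q [QA QI]] := push_probability pi (@measurable_fst _ _ X X).
move=> bF; rewrite -(bint_transfer (@measurable_fst _ _ X X) QI bF).
rewrite /Rintegral; congr fine; apply: eq_measure_integral => A mA _.
apply: etrans (QA A) _; apply: etrans (proj1 munu A mA).
by congr (pi _); apply/seteqP; split=> z //= [].
Qed.

Lemma coupling_snd F : bmeas F -> \int[pi]_z F z.2 = \int[nu]_x F x.
Proof.
have [Q [QA QI]] := push_probability pi (@measurable_snd _ _ X X).
move=> bF; rewrite -(bint_transfer (@measurable_snd _ _ X X) QI bF).
rewrite /Rintegral; congr fine; apply: eq_measure_integral => A mA _.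
apply: etrans (QA A) _; apply: etrans (proj2 munu A mA).
by congr (pi _); apply/seteqP; split=> z //= [].
Qed.

End couplings.

(** * Transport of measures and couplings to an approximating space *)

Section recovery.
Context dX (X : measurableType dX) (R : realType) (dist : X -> X -> R).
Hypothesis dist_metric : is_metric dist.
Hypothesis dist_compact : dcompact dist.
Hypothesis dist_borel : borel_of dist.
Context dY (Y : measurableType dY) (distY : Y -> Y -> R).
Hypothesis distY_metric : is_metric distY.
Hypothesis distY_compact : dcompact distY.
Hypothesis distY_borel : borel_of distY.
Variables (mY : {measure set Y -> \bar R}) (phi : Y -> X) (eps : R).
Hypothesis mYfin : (mY setT < +oo)%E.
Hypothesis mphi : measurable_fun setT phi.
Hypothesis phi_approx : eps_approx distY dist phi eps.
Hypothesis eps0 : 0 <= eps.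
Variables (delta : R) (N : nat) (c : 'I_N -> X) (h : 'I_N -> X -> R).
Hypothesis delta0 : 0 <= delta.
Hypothesis PU : partition_of_unity dist delta c h.

Let distC : forall x y, dist x y = dist y x. Proof. by case: dist_metric. Qed.
Let distD : forall x y z, dist x z <= dist x y + dist y z.
Proof. by case: dist_metric. Qed.

Let bh l : bmeas (h l).
Proof. by apply: (lipschitz1_bmeas dist_metric dist_compact dist_borel); case: PU. Qed.

Let bhphi l : bmeas (fun y => h l (phi y)).
Proof.
case: (bh l) => mh [M hM]; split; last by exists M.
exact: measurableT_comp mh mphi.
Qed.

Definition local_mass l := \int[mY]_y h l (phi y).

(* Upper bounds suffice: applied to [f] and [- f] they control the integral of [f]. *)
Definition localized (lam : probability Y R) l := forall (f : Y -> R) C, bmeas f ->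
  (forall y, dist (c l) (phi y) <= delta + eps -> f y <= C) -> \int[lam]_y f y <= C.

(* When [local_mass l] vanishes, a Dirac mass near [c l] is used instead. *)
Lemma localized_exists l : exists lam : probability Y R, localized lam l /\
  (0 < local_mass l -> forall A, measurable A ->
     lam A = (\int[mY]_(y in A) (h l (phi y) / local_mass l)%:E)%E).
Proof.
have [_ h0 _ hc] := PU; have [b0|b0] := ltP 0 (local_mass l); last first.
  have [y yl] := (proj2 phi_approx) (c l); exists \d_y; split=> // f C bf fC.
  rewrite /Rintegral integral_dirac//; last by apply/measurable_EFinP; case: bf.
  rewrite diracT mul1e /=; apply: fC; apply: le_trans yl _.
  by rewrite lerDr.
pose rho y := h l (phi y) / local_mass l.
have brho : bmeas rho.
  by rewrite /rho; under eq_fun do rewrite mulrC; exact: bmeasZ.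
have rho0 y : 0 <= rho y by rewrite divr_ge0// ltW.
have rho1 : \int[mY]_y rho y = 1.
  rewrite /rho; under eq_Rintegral do rewrite mulrC.
  by rewrite bintZ// mulVf// gt_eqF.
have [lam lamE] : exists P : probability Y R,
    forall A, measurable A -> P A = (\int[mY]_(y in A) (rho y)%:E)%E.
  by apply: density_probability => //; [case: brho|rewrite bint_EFin// rho1].
exists lam; split=> // f C bf fC.
have mrho : measurable_fun setT rho by case: brho.
rewrite (bint_density mrho rho0 lamE bf).
have -> : C = \int[mY]_y (C * rho y) by rewrite bintZ// rho1 mulr1.
apply: le_bint => //; [exact: bmeasM|exact: bmeasZ|] => y.
have [hy|hy] := eqVneq (h l (phi y)) 0.
  by rewrite /rho hy mul0r !mulr0.
rewrite ler_wpM2r// fC//; apply: le_trans (hc _ _ hy) _.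
by rewrite lerDl.
Qed.

Variables (lam : 'I_N -> probability Y R) (y : 'I_N -> Y).
Hypothesis lam_loc : forall l, localized (lam l) l.
Hypothesis y_near : forall l, dist (c l) (phi (y l)) <= eps.

Let distY2 := dist_sq_bmeas distY_metric distY_compact distY_borel.

Lemma localized_dist (f : Y -> R) a C l : bmeas f ->
  (forall y, dist (c l) (phi y) <= delta + eps -> `|f y - a| <= C) ->
  `|\int[lam l]_y f y - a| <= C.
Proof.
move=> bf fC; have lfin := probability_lty (lam l).
rewrite ler_norml lerBrDr lerBlDr; apply/andP; split; last first.
  by apply: lam_loc => // z /fC; rewrite ler_norml; lra.
have : \int[lam l]_y (-1 * f y) <= C - a.
  apply: lam_loc; first exact: bmeasZ.
  by move=> z /fC; rewrite ler_norml; lra.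
by rewrite bintZ//; lra.
Qed.

Lemma recovery_weak (mu : probability X R) (muY : probability Y R) (F : X -> R) L :
  (forall f, bmeas f -> \int[muY]_y f y = \sum_l (\int[mu]_x h l x) * \int[lam l]_y f y) ->
  0 <= L -> (forall x x', `|F x - F x'| <= L * dist x x') ->
  `|\int[muY]_y F (phi y) - \int[mu]_x F x| <= L * (2 * delta + eps).
Proof.
move=> muYE L0 FL; have [_ h0 h1 hc] := PU.
have bF : bmeas F.
  by apply: (lipschitz1_bmeas dist_metric dist_compact dist_borel); exists L.
have bFphi : bmeas (fun y => F (phi y)).
  case: bF => mF [M FM]; split; last by exists M.
  exact: measurableT_comp mF mphi.
have mufin := probability_lty mu.
have bhF l : bmeas (fun x => F (c l) * h l x) by exact: bmeasZ.
have sum1 : \sum_l \int[mu]_x h l x = 1.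
  rewrite -bint_sum//; under eq_Rintegral do rewrite h1.
  by rewrite bint_cst [X in fine X](@probability_setT _ _ _ mu) mulr1.
(* Both integrals are compared with the sum of the [F (c l)] weighted by the masses: the distance to
   [c l] is at most [delta + eps] on the [Y] side and [delta] on the [X] side. *)
have H1 : `|\int[muY]_y F (phi y) - \sum_l F (c l) * \int[mu]_x h l x| <= L * (delta + eps).
  rewrite muYE// -[leRHS]mul1r -sum1 mulr_suml.
  under [X in _ - X]eq_bigr do rewrite mulrC.
  rewrite -sumrB; apply: le_trans (ler_norm_sum _ _ _) _.
  apply: ler_sum => l _; rewrite -mulrBr normrM ger0_norm ?bint_ge0//.
  rewrite ler_wpM2l ?bint_ge0//; apply: localized_dist => // z cz.
  by apply: le_trans (FL _ _) _; rewrite ler_wpM2l// distC.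
have H2 : `|\sum_l F (c l) * \int[mu]_x h l x - \int[mu]_x F x| <= L * delta.
  have -> : \sum_l F (c l) * \int[mu]_x h l x = \int[mu]_x \sum_l F (c l) * h l x.
    by rewrite bint_sum//; apply: eq_bigr => l _; rewrite bintZ.
  rewrite -[leRHS]mulr1 -[X in _ * X]/(fine 1%E) -(@probability_setT _ _ _ mu).
  apply: dist_bint => //; first exact: bmeas_sum.
  move=> x; rewrite -[X in _ - X]mul1r -(h1 x) mulr_suml -sumrB.
  rewrite -[leRHS]mul1r -(h1 x) mulr_suml; apply: le_trans (ler_norm_sum _ _ _) _.
  apply: ler_sum => l _; rewrite (mulrC (F _)) -mulrBr normrM ger0_norm//.
  have [->|hx] := eqVneq (h l x) 0; first by rewrite !mul0r.
  by rewrite ler_wpM2l//; apply: le_trans (FL _ _) _; rewrite ler_wpM2l// hc.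
have -> : \int[muY]_y F (phi y) - \int[mu]_x F x =
  (\int[muY]_y F (phi y) - \sum_l F (c l) * \int[mu]_x h l x) +
  (\sum_l F (c l) * \int[mu]_x h l x - \int[mu]_x F x) by ring.
by apply: le_trans (ler_normD _ _) _; lra.
Qed.

(* The plan [piY] is the sum over [l, l'] of the mass given by [pi] to [h l (x) h l'],
   times [lam l (x) \d_(y l')]. *)
Lemma recovery_coupling (mu nu : probability X R) (pi : probability (X * X)%type R)
    (muY nuY : probability Y R) (D : R) :
  coupling mu nu pi -> (forall x x', dist x x' <= D) ->
  (forall A, muY A = (\sum_l (\int[mu]_x h l x)%:E * lam l A)%E) ->
  (forall A, nuY A = (\sum_l (\int[nu]_x h l x)%:E * \d_(y l) A)%E) ->
  exists2 piY : probability (Y * Y)%type R, coupling muY nuY piY &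
    \int[piY]_z distY z.1 z.2 ^+ 2 <=
    \int[pi]_z dist z.1 z.2 ^+ 2 + (3 * (delta + eps)) * (2 * D + 3 * (delta + eps)).
Proof.
move=> munu distD' muYE nuYE; have [_ h0 h1 hc] := PU.
have d0 : forall x y, 0 <= dist x y by exact: dist_ge0.
have dY0 : forall x y, 0 <= distY x y by exact: dist_ge0.
have pifin := probability_lty pi.
pose H (l : 'I_N * 'I_N) (z : X * X) := h l.1 z.1 * h l.2 z.2.
have H0 l z : 0 <= H l z by exact: mulr_ge0.
have bH1 l : bmeas (fun z : X * X => h l z.1).
  by case: (bh l) => mh [M hM]; split; [exact: measurableT_comp|exists M].
have bH2 l : bmeas (fun z : X * X => h l z.2).
  by case: (bh l) => mh [M hM]; split; [exact: measurableT_comp|exists M].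
have bH l : bmeas (H l) by exact: bmeasM.
pose q l := \int[pi]_z H l z.
have q0 l : 0 <= q l by exact: bint_ge0.
have q_fst l : \sum_l' q (l, l') = \int[mu]_x h l x.
  rewrite -(coupling_fst munu)// -bint_sum//.
  by apply: eq_Rintegral => z _; rewrite /H /= -mulr_sumr h1 mulr1.
have q_snd l' : \sum_l q (l, l') = \int[nu]_x h l' x.
  rewrite -(coupling_snd munu)// -bint_sum//.
  by apply: eq_Rintegral => z _; rewrite /H /= -mulr_suml h1 mul1r.
have sumH z : \sum_l H l z = 1.
  rewrite -(pair_big xpredT xpredT (fun l l' => H (l, l') z))/= -[RHS](h1 z.1).
  by apply: eq_bigr => l _; rewrite /H /= -mulr_sumr h1 mulr1.
have q1 : \sum_l q l = 1.
  rewrite -bint_sum//; under eq_Rintegral do rewrite sumH.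
  by rewrite bint_cst [X in fine X](@probability_setT _ _ _ pi) mulr1.
have mpair (w : Y) : measurable_fun setT (fun z : Y => (z, w)).
  by apply: measurable_fun_pair => //; exact: measurable_cst.
have /choice[P PE] (l : 'I_N * 'I_N) := push_probability (lam l.1) (mpair (y l.2)).
have [piY [piYA piYI]] := mixture_bint P q0 q1.
have sumq (F : 'I_N -> 'I_N -> \bar R) : (forall l l', 0 <= F l l')%E ->
    (\sum_l (q l)%:E * F l.1 l.2 = \sum_l \sum_l' (q (l, l'))%:E * F l l')%E.
  by move=> F0; rewrite (pair_big xpredT xpredT (fun l l' => (q (l, l'))%:E * F l l')%E)/=;
    apply: eq_bigr => -[].
exists piY.
  split=> [A mA|B mB]; rewrite piYA.
    rewrite muYE; under eq_bigr => l _.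
      rewrite (PE l).1 (_ : _ @^-1` _ = A); last by apply/seteqP; split=> z //= [].
      over.
    rewrite (sumq (fun l _ => lam l A)) => [|l _]; last exact: measure_ge0.
    apply: eq_bigr => l _; rewrite -q_fst -sumEFin ge0_sume_distrl//.
    by move=> l' _; rewrite lee_fin.
  rewrite nuYE; under eq_bigr => l _.
    rewrite (PE l).1 (_ : lam l.1 _ = \d_(y l.2) B); last first.
      rewrite diracE; have [yB|yB] := boolP (y l.2 \in B).
        rewrite (_ : _ @^-1` _ = setT) ?probability_setT//.
        by apply/seteqP; split=> z //= _; split=> //; exact: set_mem.
      rewrite (_ : _ @^-1` _ = set0) ?measure0//.
      by apply/seteqP; split=> z //= [_ yBz]; move: yB; rewrite mem_set.
    over.
  rewrite (sumq (fun _ l' => \d_(y l') B)) => [|_ l']; last exact: measure_ge0.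
  rewrite exchange_big/=; apply: eq_bigr => l' _; rewrite -q_snd -sumEFin ge0_sume_distrl//.
  by move=> l _; rewrite lee_fin.
set eta := 3 * (delta + eps); have eta0 : 0 <= eta by rewrite mulr_ge0 ?addr_ge0.
have D0 : 0 <= D by exact: le_trans (d0 point point) (distD' _ _).
have bd2 := dist_sq_bmeas dist_metric dist_compact dist_borel.
(* On the piece indexed by [l], [distY] exceeds [dist (c l.1) (c l.2)] by at most [delta + eps] and
   [eps] at the two ends plus [eps] of distortion. Where [H l z] is not zero, [dist (c l.1) (c l.2)]
   is at most [dist z.1 z.2 + 2 * delta]. Together these give [eta]. *)
pose k l := (dist (c l.1) (c l.2) + delta + 3 * eps) ^+ 2.
rewrite piYI//; apply: (@le_trans _ _ (\sum_l q l * k l)).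
  apply: ler_sum => l _; rewrite ler_wpM2l//.
  rewrite (bint_transfer (mpair (y l.2)) (PE l).2)//=; apply: lam_loc.
    case: distY2 => md [M dM]; split; last by exists M => z; exact: (dM (z, y l.2)).
    exact: measurableT_comp md (mpair (y l.2)).
  move=> z cz; rewrite /k ler_pXn2r ?nnegrE ?addr_ge0 ?mulr_ge0//.
  have := (proj1 phi_approx) z (y l.2); rewrite ler_norml => /andP[+ _].
  have := distD (phi z) (c l.1) (phi (y l.2)).
  have := distD (c l.1) (c l.2) (phi (y l.2)).
  by rewrite (distC (phi z) (c l.1)); have := y_near l.2; lra.
have -> : \sum_l q l * k l = \int[pi]_z \sum_l k l * H l z.
  rewrite bint_sum//; last by move=> l; exact: bmeasZ.
  by apply: eq_bigr => l _; rewrite bintZ// mulrC.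
have -> : \int[pi]_z dist z.1 z.2 ^+ 2 + eta * (2 * D + eta) =
    \int[pi]_z (dist z.1 z.2 ^+ 2 + eta * (2 * D + eta)).
  rewrite bintD//; last exact: bmeas_cst.
  by rewrite bint_cst [X in fine X](@probability_setT _ _ _ pi) mulr1.
apply: le_bint => //.
- by apply: bmeas_sum => l; exact: bmeasZ.
- by apply: bmeasD => //; exact: bmeas_cst.
move=> z; set K := _ ^+ 2 + _; rewrite -[K]mulr1 -(sumH z) mulr_sumr.
apply: ler_sum => l _; have [->|Hz] := eqVneq (H l z) 0; first by rewrite !mulr0.
rewrite ler_wpM2r//; move: Hz; rewrite /H mulf_eq0 negb_or => /andP[/hc c1 /hc c2].
apply: (@le_trans _ _ ((dist z.1 z.2 + eta) ^+ 2)).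
  rewrite /k ler_pXn2r ?nnegrE//; [|by rewrite !addr_ge0 ?mulr_ge0|exact: addr_ge0].
  have := distD (c l.1) z.1 (c l.2); have := distD z.1 z.2 (c l.2).
  by rewrite (distC z.2) /eta; lra.
rewrite /K sqrrD -addrA lerD2l expr2 [leRHS]mulrDr lerD2r.
have := ler_wpM2l eta0 (distD' z.1 z.2).
by rewrite mulr2n; lra.
Qed.

(** Jensen is applied at each point with the weights [h l (phi z)]; after integration
    [local_mass l * s l] collapses to the mass of [h l] under [mu]. *)
Lemma recovery_entropy (mu : probability X R) (muY : probability Y R) :
  (forall l, 0 < \int[mu]_x h l x -> 0 < local_mass l) ->
  (forall l, 0 < local_mass l -> forall A, measurable A ->
     lam l A = (\int[mY]_(y in A) (h l (phi y) / local_mass l)%:E)%E) ->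
  (forall A, muY A = (\sum_l (\int[mu]_x h l x)%:E * lam l A)%E) ->
  (Ent mY muY <=
   (\sum_l \int[mu]_x h l x * ln (\int[mu]_x h l x / local_mass l))%:E)%E.
Proof.
move=> CB lamE muYE; have [_ h0 h1 _] := PU.
set C := fun l => \int[mu]_x h l x; set B := local_mass.
have C0 l : 0 <= C l by exact: bint_ge0.
have B0 l : 0 <= B l by exact: bint_ge0.
pose s l := C l / B l.
have s0 l : 0 <= s l by rewrite divr_ge0.
pose rho z := \sum_l h l (phi z) * s l.
have bhs (a : 'I_N -> R) l : bmeas (fun z => h l (phi z) * a l).
  by apply: bmeasM => //; exact: bmeas_cst.
have brho : bmeas rho by apply: bmeas_sum => l; exact: (bhs s).
have mrho : measurable_fun setT rho by case: brho.
have rho0 z : 0 <= rho z by apply: sumr_ge0 => l _; exact: mulr_ge0.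
apply: ge_ereal_inf; exists (\int[mY]_z (rho z * ln (rho z))%:E)%E.
  exists rho; split=> // A mA; rewrite muYE.
  rewrite (_ : (\int[mY]_(x in A) _)%E =
    (\int[mY]_(x in A) \sum_l (h l (phi x) * s l)%:E)%E); last first.
    by apply: eq_integral => z _; rewrite sumEFin.
  rewrite ge0_integral_sum//; last 2 first.
  - move=> l; apply/measurable_funTS/measurable_EFinP; exact: (bhs s l).1.
  - by move=> l z _; rewrite lee_fin mulr_ge0.
  apply: eq_bigr => l _; rewrite -/(C l).
  have [Cl|Cl] := eqVneq (C l) 0.
    rewrite Cl mul0e; apply/esym/integral0_eq => z _.
    by rewrite /s Cl mul0r mulr0.
  have Bl : 0 < B l by apply: CB; rewrite lt_neqAle eq_sym Cl C0.
  rewrite lamE// -ge0_integralZl//; last 3 first.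
  - apply/measurable_funTS/measurable_EFinP.
    by apply: measurable_funM => //; case: (bhphi l).
  - by move=> z _; rewrite lee_fin divr_ge0// ltW.
  - by rewrite lee_fin.
  apply: eq_integral => z _; rewrite -EFinM /s; congr EFin; rewrite -/(B l); ring.
pose u l := s l * ln (s l).
have bu : bmeas (fun z => \sum_l h l (phi z) * u l) by apply: bmeas_sum => l; exact: (bhs u).
have rho_le z : rho z * ln (rho z) <= \sum_l h l (phi z) * u l.
  exact: (xlnx_jensen (fun l => h0 l (phi z)) (h1 (phi z)) s0).
have brl : bmeas (fun z => rho z * ln (rho z)).
  split; first by apply: measurable_funM => //; exact: measurableT_comp.
  case: bu => _ [M uM]; exists (M + 1) => z.
  have := xlnx_dual 0 (rho0 z); rewrite mul0r sub0r => rl.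
  have e1 : expR (-1) <= 1 :> R by rewrite -[leRHS]expR0 ler_expR; lra.
  rewrite ler_norml; apply/andP.
  have := rho_le z; have := ler_norm (\sum_l h l (phi z) * u l).
  have := uM z; have := normr_ge0 (\sum_l h l (phi z) * u l).
  by move=> ? ? ? ?; split; lra.
rewrite bint_EFin// lee_fin; apply: le_trans (le_bint mYfin brl bu rho_le) _.
rewrite bint_sum//; [|by move=> l; exact: (bhs u)..].
apply: ler_sum => l _; under [leLHS]eq_Rintegral do rewrite mulrC.
rewrite bintZ// -/(B l) -/(C l) /u /s.
have [Bl|Bl] := eqVneq (B l) 0; last first.
  by rewrite mulrAC divfK.
have -> : C l = 0.
  apply/eqP; apply: contraTT isT => Cl.
  have := CB l; rewrite -/(C l) -/(B l) Bl ltxx lt_neqAle eq_sym Cl C0 /=.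
  by move=> /(_ isT).
by rewrite !mul0r.
Qed.

End recovery.

(** * Wasserstein costs, variances and barycenters *)

Section wasserstein.
Context d (X : measurableType d) (R : realType) (dist : X -> X -> R).
Hypothesis dist_metric : is_metric dist.
Hypothesis dist_compact : dcompact dist.
Hypothesis dist_borel : borel_of dist.

Let lip_bmeas := lipschitz1_bmeas dist_metric dist_compact dist_borel.
Let bd2 := dist_sq_bmeas dist_metric dist_compact dist_borel.

(** [nu] is read off from the limit plan [pi j0] alone. The other plans share it as second marginal
    because, for each [k], all [pis j k] have the same second marginal, and Lipschitz integrals
    determine a probability. First marginals are only asked to converge, as those of transported
    plans do. *)
Lemma limit_coupling (U : set_system nat) (J : Type) (j0 : J)
    (mus : J -> probability X R) (nus : nat -> probability X R)
    (pis : J -> nat -> probability (X * X)%type R) : UltraFilter U ->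
  (forall j F, lipschitz_dist dist F -> \int[pis j k]_z F z.1 @[k --> U] --> \int[mus j]_x F x) ->
  (forall j k F, lipschitz_dist dist F -> \int[pis j k]_z F z.2 = \int[nus k]_x F x) ->
  exists (nu : probability X R) (pi : J -> probability (X * X)%type R),
  [/\ forall F, lipschitz_dist dist F -> \int[nus k]_x F x @[k --> U] --> \int[nu]_x F x,
      forall j, coupling (mus j) nu (pi j) &
      forall j, \int[pis j k]_z dist z.1 z.2 ^+ 2 @[k --> U] --> \int[pi j]_z dist z.1 z.2 ^+ 2].
Proof.
move=> UU pis1 pis2.
have /choice[pi piE] j := weak_compactness2 dist_metric dist_compact dist_borel (pis j) UU.
have [nu [nuA nuI]] := push_probability (pi j0) (@measurable_snd _ _ X X).
have nuF F : lipschitz_dist dist F -> \int[nu]_x F x = \int[pi j0]_z F z.2.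
  by move=> lF; exact: (bint_transfer (@measurable_snd _ _ X X) nuI (lip_bmeas lF)).
have nus_nu F : lipschitz_dist dist F -> \int[nus k]_x F x @[k --> U] --> \int[nu]_x F x.
  move=> lF; rewrite nuF//; under eq_fun do rewrite -(pis2 j0)//.
  exact: piE (lipschitz_snd lF).
exists nu, pi; split=> //; last first.
  by move=> j; apply: piE; exact: dist_sq_lipschitz.
move=> j; split=> [A mA|A mA].
- have [Q [QA QI]] := push_probability (pi j) (@measurable_fst _ _ X X).
  rewrite (_ : A `*` setT = fst @^-1` A); last by apply/seteqP; split=> z //= [].
  rewrite -QA; apply: (probability_eq_lipschitz dist_metric dist_compact dist_borel) => //.
  move=> F lF; rewrite (bint_transfer (@measurable_fst _ _ X X) QI (lip_bmeas lF)).
  by apply: (cvg_uniqR (piE j _ (lipschitz_fst lF))); exact: pis1.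
- have [Q [QA QI]] := push_probability (pi j) (@measurable_snd _ _ X X).
  rewrite (_ : setT `*` A = snd @^-1` A); last by apply/seteqP; split=> z //= [].
  rewrite -QA; apply: (probability_eq_lipschitz dist_metric dist_compact dist_borel) => //.
  move=> F lF; rewrite (bint_transfer (@measurable_snd _ _ X X) QI (lip_bmeas lF)).
  apply: (cvg_uniqR (piE j _ (lipschitz_snd lF))).
  by under eq_fun do rewrite /= pis2//; exact: nus_nu.
Qed.

Lemma W2sq_le (mu nu : probability X R) (pi : probability (X * X)%type R) :
  coupling mu nu pi -> (W2sq dist mu nu <= (\int[pi]_z dist z.1 z.2 ^+ 2)%:E)%E.
Proof.
move=> munu; rewrite -bint_EFin//; last exact: probability_lty.
by apply: ereal_inf_lbound; exists pi.
Qed.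

Lemma W2sq_ge0 (mu nu : probability X R) : (0 <= W2sq dist mu nu)%E.
Proof.
apply: le_ereal_inf_tmp => _ [pi [_ ->]]; apply: integral_ge0 => z _.
by rewrite lee_fin sqr_ge0.
Qed.

Lemma W2sq_fin_num (mu nu : probability X R) : W2sq dist mu nu \is a fin_num.
Proof.
rewrite ge0_fin_numE ?W2sq_ge0//.
have [pi [piA _]] := @probability_of_measure _ _ R (mu \x nu)%E (@probability_setT _ _ _ _).
apply: le_lt_trans (ltry (\int[pi]_z dist z.1 z.2 ^+ 2)); apply: W2sq_le.
split=> A mA; rewrite piA /= product_measure1E//.
  by rewrite [X in (_ * X)%E](@probability_setT _ _ _ nu) mule1.
by rewrite [X in (X * _)%E](@probability_setT _ _ _ mu) mul1e.
Qed.

Lemma near_optimal_coupling (mu nu : probability X R) (e : R) : 0 < e ->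
  exists pi : probability (X * X)%type R, coupling mu nu pi /\
    \int[pi]_z dist z.1 z.2 ^+ 2 <= fine (W2sq dist mu nu) + e.
Proof.
move=> e0; have [_ [pi [munu ->]] lte] :=
  lb_ereal_inf_adherent e0 (W2sq_fin_num mu nu).
exists pi; split=> //; rewrite -lee_fin -bint_EFin//; last exact: probability_lty.
by rewrite EFinD fineK ?W2sq_fin_num// ltW.
Qed.

Section variance.
Variables (n : nat) (lam : 'I_n -> R) (mus : 'I_n -> probability X R).
Hypothesis lamP : prob_weights lam.

Lemma wcostE nu : wcost dist lam mus nu = (\sum_j lam j * fine (W2sq dist (mus j) nu))%:E.
Proof.
rewrite /wcost -sumEFin; apply: eq_bigr => j _.
by rewrite EFinM fineK ?W2sq_fin_num.
Qed.

Lemma Var_le nu : (Var dist lam mus <= wcost dist lam mus nu)%E.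
Proof. by apply: ereal_inf_lbound; exists nu. Qed.

Lemma Var_ge0 : (0 <= Var dist lam mus)%E.
Proof.
apply: le_ereal_inf_tmp => _ [nu _ <-]; apply: sume_ge0 => j _.
by rewrite mule_ge0 ?W2sq_ge0// lee_fin; case: lamP.
Qed.

Lemma weights_nonempty : 'I_n.
Proof.
case: n lam lamP => [l [_]|n' _ _]; last exact: ord0.
by rewrite big_ord0 => /esym/eqP; rewrite oner_eq0.
Qed.

Lemma Var_fin_num : Var dist lam mus \is a fin_num.
Proof.
rewrite ge0_fin_numE ?Var_ge0//; apply: le_lt_trans (Var_le (mus weights_nonempty)) _.
by rewrite wcostE ltry.
Qed.

End variance.

(** The variance is at most the cost of [nu], which is at most the cost of the plans [pi j]; the
    hypothesis closes the circle. The second conclusion is what yields the convergence of the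
    variances. *)
Lemma barycenter_of_limit n (lam : 'I_n -> R) (mus : 'I_n -> probability X R)
    (nu : probability X R) (pi : 'I_n -> probability (X * X)%type R) :
  prob_weights lam -> (forall j, coupling (mus j) nu (pi j)) ->
  ((\sum_j lam j * \int[pi j]_z dist z.1 z.2 ^+ 2)%:E <= Var dist lam mus)%E ->
  is_barycenter dist lam mus nu /\
  (\sum_j lam j * \int[pi j]_z dist z.1 z.2 ^+ 2)%:E = Var dist lam mus.
Proof.
move=> [lam0 lam1] piE pi_le.
have le_pi : (wcost dist lam mus nu <= (\sum_j lam j * \int[pi j]_z dist z.1 z.2 ^+ 2)%:E)%E.
  rewrite -sumEFin; apply: lee_sum => j _; rewrite EFinM.
  by apply: lee_wpmul2l; [rewrite lee_fin|exact: W2sq_le].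
have Vle := @Var_le _ lam mus nu.
split; apply/eqP; rewrite eq_le.
  by rewrite Vle (le_trans le_pi).
by rewrite pi_le (le_trans Vle).
Qed.

Lemma barycenter_exists n (lam : 'I_n -> R) (mus : 'I_n -> probability X R) :
  prob_weights lam -> exists nu, is_barycenter dist lam mus nu.
Proof.
move=> lamP; have [lam0 lam1] := lamP.
have Vfin := @Var_fin_num _ _ mus lamP.
have e0 k : 0 < k.+1%:R^-1 :> R by rewrite invr_gt0.
have /choice[nus nusE] k : exists nu,
    \sum_j lam j * fine (W2sq dist (mus j) nu) <= fine (Var dist lam mus) + k.+1%:R^-1.
  have [_ [nu _ <-] lte] := lb_ereal_inf_adherent (e0 k) Vfin.
  by exists nu; rewrite -lee_fin EFinD fineK// -wcostE ltW.
have /choice[pis pisE] (jk : 'I_n * nat) :=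
  near_optimal_coupling (mus jk.1) (nus jk.2) (e0 jk.2).
have [U [UU sU]] := @ultraFilterLemma _ (\oo : set_system nat) _.
have [j F lF|j k F lF|nu [pi [_ piE pid]]] := @limit_coupling U _ (weights_nonempty lamP)
    mus nus (fun j k => pis (j, k)) UU.
- under eq_fun do rewrite (coupling_fst (pisE (j, _)).1 (lip_bmeas lF)).
  exact: cvg_cst.
- by have := coupling_snd (pisE (j, k)).1 (lip_bmeas lF).
exists nu; apply: (proj1 (barycenter_of_limit lamP piE _)).
rewrite -(fineK Vfin) lee_fin -[leRHS]addr0.
have cvgS : \sum_j lam j * \int[pis (j, k)]_z dist z.1 z.2 ^+ 2 @[k --> U] -->
    \sum_j lam j * \int[pi j]_z dist z.1 z.2 ^+ 2.
  by apply: cvg_sumR => j; apply: cvgMr; exact: pid.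
(* One [1 / (k + 1)] is the defect of [nus k] as a minimizer, the other that of the chosen
   couplings, averaged with weights of sum 1. *)
have cvgV : fine (Var dist lam mus) + 2 * k.+1%:R^-1 @[k --> U] -->
    fine (Var dist lam mus) + 2 * 0.
  apply: cvgD; first exact: cvg_cst.
  by apply: cvgMr; apply: cvg_trans (@cvg_harmonic R); exact: cvg_app sU.
rewrite mulr0 in cvgV; apply: ler_cvg_to cvgS cvgV _; apply: nearW => k.
apply: le_trans (_ : _ <= \sum_j lam j * (fine (W2sq dist (mus j) (nus k)) + k.+1%:R^-1)) _.
  by apply: ler_sum => j _; rewrite ler_wpM2l//; exact: (pisE (j, k)).2.
under eq_bigr do rewrite mulrDr.
rewrite big_split/= -mulr_suml lam1 mul1r.
by have := nusE k; move: (k.+1%:R^-1) => e; lra.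
Qed.

End wasserstein.

(** * Stability *)

(* With [delta, eps <= t]: the first term bounds the error of [recovery_coupling], the
   second the lack of optimality of the chosen couplings, the third the distortion of
   the squared distance under the approximation map. *)
Definition transfer_error (R : realType) (D t : R) :=
  (6 * t) * (2 * D + 6 * t) + t + t * (2 * (D + t) + t).

Section recovery_step.
Context dX (X : measurableType dX) (R : realType) (dist : X -> X -> R)
  (m : {measure set X -> \bar R}).
Context dY (Y : measurableType dY) (distY : Y -> Y -> R)
  (mY : {measure set Y -> \bar R}).
Hypothesis X_mms : compact_mms dist m.
Hypothesis Y_mms : compact_mms distY mY.
Variables (K : R) (phi : Y -> X) (eps : R).
Hypothesis Y_BCD : BCD distY mY K.
Hypothesis mphi : measurable_fun setT phi.
Hypothesis phi_approx : eps_approx distY dist phi eps.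
Hypothesis eps0 : 0 <= eps.
Variables (D t : R) (N : nat) (c : 'I_N -> X) (h : 'I_N -> X -> R).
Hypothesis dist_le : forall x x', dist x x' <= D.
Hypothesis t0 : 0 < t.
Hypothesis eps_t : eps <= t.
Hypothesis PU : partition_of_unity dist t c h.
Variables (n : nat) (w : 'I_n -> R) (mus : 'I_n -> probability X R) (r : 'I_n -> R).
Hypothesis wP : prob_weights w.
Hypothesis mass_gt0 : forall j l,
  0 < \int[mus j]_x h l x -> 0 < local_mass mY phi h l.
Hypothesis entropy_r : forall j,
  \sum_l \int[mus j]_x h l x * ln (\int[mus j]_x h l x / local_mass mY phi h l) <= r j.

(** [v] is the variance on [Y]. Apart from the integral against [mY], everything is expressed on
    [X], so that the limit over varying spaces becomes one on a fixed space. The entropy bound is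
    kept in dual form, with tests pulled back by [phi]. *)
Lemma recovery_step : exists (nuX : probability X R)
    (pis : 'I_n -> probability (X * X)%type R) (v : R),
  [/\ forall j F L, 0 <= L -> (forall x x', `|F x - F x'| <= L * dist x x') ->
        `|\int[pis j]_z F z.1 - \int[mus j]_x F x| <= L * (3 * t),
      forall j F, bmeas F -> \int[pis j]_z F z.2 = \int[nuX]_x F x,
      \sum_j w j * \int[pis j]_z dist z.1 z.2 ^+ 2 <= v + transfer_error D t,
      v <= fine (Var dist w mus) + transfer_error D t &
      forall f, bmeas f -> \int[nuX]_x f x - \int[mY]_y expR (f (phi y) - 1) <=
        \sum_j w j * r j - K / 2 * v].
Proof.
have [Xm Xc Xb mfin] := X_mms; have [Ym Yc Yb mYfin] := Y_mms.
have [w0 w1] := wP; have [_ h0 h1 _] := PU.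
have [t_gt0 eps_ge0 eps_le] := And3 t0 eps0 eps_t.
have lipX := lipschitz1_bmeas Xm Xc Xb.
have bh l : bmeas (h l) by apply: lipX; case: PU.
have d0 : forall x y, 0 <= dist x y by exact: dist_ge0.
have dY0 : forall x y, 0 <= distY x y by exact: dist_ge0.
have D0 : 0 <= D by exact: le_trans (d0 point point) (dist_le _ _).
have bX2 := dist_sq_bmeas Xm Xc Xb; have bY2 := dist_sq_bmeas Ym Yc Yb.
have bphi (f : X -> R) : bmeas f -> bmeas (fun y => f (phi y)).
  by move=> [mf [M fM]]; split; [exact: measurableT_comp mf mphi|exists M].
have /choice[lam lamP] := localized_exists Xm Xc Xb mYfin mphi phi_approx eps0 (ltW t0) PU.
have /choice[y y_near] l := (proj2 phi_approx) (c l).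
have lam_loc l : localized dist phi eps t c (lam l) l by case: (lamP l).
have sum1 (mu : probability X R) : \sum_l \int[mu]_x h l x = 1.
  have mufin := probability_lty mu.
  rewrite -bint_sum//; under eq_Rintegral do rewrite h1.
  by rewrite bint_cst [X in fine X](@probability_setT _ _ _ mu) mulr1.
have C0 (mu : probability X R) l : 0 <= \int[mu]_x h l x by exact: bint_ge0.
have /choice[musY musYP] j := mixture_bint lam (C0 (mus j)) (sum1 (mus j)).
have [nuY [nuY_bar nuY_Ent]] : exists nu : probability Y R,
    is_barycenter distY w musY nu /\
    (Ent mY nu <= \sum_(j < n) (w j)%:E * Ent mY (musY j)
                   - (K / 2)%:E * Var distY w musY)%E.
  by apply: Y_BCD => //; rewrite ltey_eq Var_fin_num.
have [v vE] : exists v : R, Var distY w musY = v%:E.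
  by exists (fine (Var distY w musY)); rewrite fineK// Var_fin_num.
have [nuX [_ nuXI]] := push_probability nuY mphi.
have nuXE f : bmeas f -> \int[nuX]_x f x = \int[nuY]_y f (phi y).
  by move=> bf; exact: (bint_transfer mphi nuXI bf).
have /choice[piY piYP] j := near_optimal_coupling Ym Yc Yb (musY j) nuY t0.
pose phi2 (z : Y * Y) := (phi z.1, phi z.2).
have mphi2 : measurable_fun setT phi2.
  by apply: measurable_fun_pair; exact: measurableT_comp.
have /choice[pis pisP] j := push_probability (piY j) mphi2.
have pisE j (F : X * X -> R) : bmeas F -> \int[pis j]_z F z = \int[piY j]_z F (phi2 z).
  by move=> bF; exact: (bint_transfer mphi2 (pisP j).2 bF).
have b1 (f : X -> R) : bmeas f -> bmeas (fun z : X * X => f z.1).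
  by move=> [mf [M fM]]; split; [exact: measurableT_comp|exists M].
have b2 (f : X -> R) : bmeas f -> bmeas (fun z : X * X => f z.2).
  by move=> [mf [M fM]]; split; [exact: measurableT_comp|exists M].
exists nuX, pis, v; split.
- move=> j F L L0 FL; have bF : bmeas F by apply: lipX; exists L.
  rewrite pisE/=; last exact: b1.
  rewrite (coupling_fst (piYP j).1 (bphi F bF)).
  apply: le_trans (recovery_weak Xm Xc Xb mphi PU lam_loc _ L0 FL) _.
  + by case: (musYP j).
  + by rewrite ler_wpM2l//; lra.
- move=> j F bF; rewrite pisE/=; last exact: b2.
  by rewrite (coupling_snd (piYP j).1 (bphi F bF)) nuXE.
- have DY z z' : distY z z' <= D + t.
    have := (proj1 phi_approx) z z'; rewrite ler_norml => /andP[+ _].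
    by have := dist_le (phi z) (phi z'); lra.
  apply: (@le_trans _ _ (\sum_j w j *
      (fine (W2sq distY (musY j) nuY) + t + t * (2 * (D + t) + t)))).
    apply: ler_sum => j _; rewrite ler_wpM2l//.
    apply: le_trans (lerD (piYP j).2 (lexx _)).
    have pfin := probability_lty (piY j).
    have -> : t * (2 * (D + t) + t) = \int[piY j]_z (t * (2 * (D + t) + t)).
      by rewrite bint_cst [X in fine X](@probability_setT _ _ _ (piY j)) mulr1.
    rewrite pisE// -bintD//; last exact: bmeas_cst.
    apply: le_bint => //.
    + case: bX2 => m2 [M M2]; split; first exact: measurableT_comp m2 mphi2.
      by exists M => z; exact: (M2 (phi2 z)).
    + by apply: bmeasD => //; exact: bmeas_cst.
    move=> z /=; apply: (@le_trans _ _ ((distY z.1 z.2 + t) ^+ 2)).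
      rewrite ler_pXn2r ?nnegrE ?addr_ge0 ?(ltW t0)//.
      have := (proj1 phi_approx) z.1 z.2; rewrite ler_norml => /andP[_].
      by lra.
    have := ler_wpM2l (ltW t0) (DY z.1 z.2).
    by rewrite sqrrD mulr2n expr2 expr2; lra.
  under eq_bigr do rewrite -addrA mulrDr.
  rewrite big_split/= -mulr_suml w1 mul1r /transfer_error.
  have -> : \sum_j w j * fine (W2sq distY (musY j) nuY) = v.
    by apply: EFin_inj; rewrite -wcostE// nuY_bar.
  have : 0 <= 6 * t * (2 * D + 6 * t) by rewrite mulr_ge0 ?addr_ge0 ?mulr_ge0// ltW.
  lra.
- have Vfin := Var_fin_num Xm Xc Xb mus wP.
  rewrite -lee_fin EFinD fineK// -vE; set err := transfer_error D t.
  rewrite -leeBlDr//; apply: le_ereal_inf_tmp => _ [nu' _ <-]; rewrite leeBlDr//.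
  (* A competitor enters the variance only through its cost, so [nu'] may be transported to Dirac
     masses at the [y l]. *)
  have [nuY' [nuY'A _]] := mixture_bint (fun l => (\d_(y l) : probability Y R)) (C0 nu') (sum1 nu').
  apply: le_trans (Var_le _ _ _ nuY') _.
  rewrite !wcostE// -EFinD lee_fin.
  have errE : err = \sum_j w j * err by rewrite -mulr_suml w1 mul1r.
  rewrite errE -big_split/=; apply: ler_sum => j _; rewrite -mulrDr ler_wpM2l//.
  have [pi [pic pile]] := near_optimal_coupling Xm Xc Xb (mus j) nu' t0.
  have [piY' piY'c piY'le] := recovery_coupling Xm Xc Xb Ym Yc Yb phi_approx eps0 (ltW t0)
    PU lam_loc y_near pic dist_le (musYP j).1 nuY'A.
  have := W2sq_le Ym Yc Yb piY'c.
  rewrite -(fineK (W2sq_fin_num Ym Yc Yb _ _)) lee_fin => W2le.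
  apply: le_trans W2le _; apply: le_trans piY'le _.
  have e6 : 3 * (t + eps) <= 6 * t by lra.
  have e60 : 0 <= 3 * (t + eps) by lra.
  have : 3 * (t + eps) * (2 * D + 3 * (t + eps)) <= 6 * t * (2 * D + 6 * t).
    by apply: ler_pM => //; [rewrite addr_ge0// mulr_ge0|rewrite lerD2l].
  have : 0 <= t * (2 * (D + t) + t) by rewrite mulr_ge0 ?addr_ge0 ?mulr_ge0 ?addr_ge0// ltW.
  rewrite /err /transfer_error; lra.
- move=> f bf; rewrite nuXE//.
  have := Ent_dual mYfin nuY (bphi _ bf) => /le_trans/(_ nuY_Ent).
  rewrite vE => /le_trans H; rewrite -lee_fin; apply: H.
  rewrite EFinB EFinM; apply: leeB => //.
  rewrite -sumEFin; apply: lee_sum => j _; rewrite EFinM.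
  apply: lee_wpmul2l; first by rewrite lee_fin.
  apply: le_trans (recovery_entropy Xm Xc Xb mYfin mphi PU (@mass_gt0 j)
    (fun l => (lamP l).2) (musYP j).1) _.
  by rewrite lee_fin; exact: entropy_r.
Qed.

End recovery_step.

Lemma lipschitz_bounded_continuous (R : realType) (T : Type) (dist : T -> T -> R) (f : T -> R) M :
  lipschitz_dist dist f -> (forall x, `|f x| <= M) -> bounded_continuous dist f.
Proof.
move=> [L L0 fL] fM; split; first by exists M.
have L1 : 0 < L + 1 by lra.
move=> x e e0; exists (e / (L + 1)); first by rewrite divr_gt0.
move=> y; rewrite ltr_pdivlMr// => xy; apply: le_lt_trans (fL x y) _.
have [d0|d0] := ltP 0 (dist x y); first by
  apply: le_lt_trans xy; rewrite mulrC ler_wpM2l ?ltW//; lra.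
apply: le_lt_trans e0; exact: mulr_ge0_le0.
Qed.

(** The zero test function bounds the entropy below by [- m(T) / e], which excludes indeterminate
    sums of entropies. *)
Lemma Ent_gtNy d (T : measurableType d) (R : realType) (m : {measure set T -> \bar R})
    (mu : probability T R) : (m setT < +oo)%E -> (-oo < Ent m mu)%E.
Proof.
by move=> mfin; apply: lt_le_trans (Ent_dual mfin mu (bmeas_cst _ 0)); exact: ltNyr.
Qed.

Section stability.
Context (R : realType) (K : R)
  (dXs : nat -> measure_display) (Xs : forall i, measurableType (dXs i))
  (dists : forall i, Xs i -> Xs i -> R) (ms : forall i, {measure set Xs i -> \bar R})
  (d : measure_display) (X : measurableType d) (dist : X -> X -> R)
  (m : {measure set X -> \bar R}).
Hypothesis Xs_mms : forall i, compact_mms (@dists i) (ms i).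
Hypothesis Xs_BCD : forall i, BCD (@dists i) (ms i) K.
Hypothesis X_mms : compact_mms dist m.
Variables (eps : nat -> R) (phis : forall i, Xs i -> X).
Hypothesis eps0 : forall i, 0 <= eps i.
Hypothesis eps_cvg : eps @ \oo --> 0.
Hypothesis phis_approx : forall i, eps_approx (@dists i) dist (@phis i) (eps i).
Hypothesis mphis : forall i, measurable_fun [set: Xs i] (@phis i).
Hypothesis ms_cvg : forall f : X -> R, bounded_continuous dist f ->
  (fun i => \int[ms i]_x (f (@phis i x))%:E)%E @ \oo --> (\int[m]_x (f x)%:E)%E.

Let Xm : is_metric dist. Proof. by case: X_mms. Qed.
Let Xc : dcompact dist. Proof. by case: X_mms. Qed.
Let Xb : borel_of dist. Proof. by case: X_mms. Qed.
Let mfin : (m setT < +oo)%E. Proof. by case: X_mms. Qed.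
Let lipX := lipschitz1_bmeas Xm Xc Xb.

Lemma lipschitz_integral_cvg f : lipschitz_dist dist f ->
  \int[ms i]_y f (@phis i y) @[i --> \oo] --> \int[m]_x f x.
Proof.
move=> lf; have bf := lipX lf; have [_ [M fM]] := bf.
have := ms_cvg (lipschitz_bounded_continuous lf fM).
by rewrite bint_EFin// => /fine_cvg.
Qed.

Section step.
Variables (n : nat) (w : 'I_n -> R) (mus : 'I_n -> probability X R) (D : R).
Hypothesis wP : prob_weights w.
Hypothesis dist_le : forall x x', dist x x' <= D.
Hypothesis Ent_fin : forall j, (Ent m (mus j) < +oo)%E.

Lemma stability_step (t : R) (k : nat) : 0 < t ->
  exists (i : nat) (nuX : probability X R)
    (pis : 'I_n -> probability (X * X)%type R) (v : R), (k <= i)%N /\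
  [/\ forall j F L, 0 <= L -> (forall x x', `|F x - F x'| <= L * dist x x') ->
        `|\int[pis j]_z F z.1 - \int[mus j]_x F x| <= L * (3 * t),
      forall j F, bmeas F -> \int[pis j]_z F z.2 = \int[nuX]_x F x,
      \sum_j w j * \int[pis j]_z dist z.1 z.2 ^+ 2 <= v + transfer_error D t,
      v <= fine (Var dist w mus) + transfer_error D t &
      forall f, bmeas f -> \int[nuX]_x f x - \int[ms i]_y expR (f (@phis i y) - 1) <=
        \sum_j w j * (fine (Ent m (mus j)) + 2 * t) - K / 2 * v].
Proof.
move=> t0; have [N [c [h PU]]] := partition_of_unity_exists Xm Xc Xb t0.
have [lh h0 _ _] := PU.
pose C j l := \int[mus j]_x h l x; pose B l := \int[m]_x h l x.
have C0 j l : 0 <= C j l by exact: bint_ge0.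
have B0 l : 0 <= B l by exact: bint_ge0.
have Bcvg l : local_mass (ms i) (@phis i) h l @[i --> \oo] --> B l.
  exact: lipschitz_integral_cvg (lh l).
have CB j l : C j l != 0 -> 0 < B l.
  move=> Cjl; rewrite lt_neqAle B0 andbT; apply: contra Cjl => /eqP Bl.
  exact/eqP/(discrete_dominates Xm Xc Xb PU mfin (Ent_fin j)).
have Entfin j : Ent m (mus j) \is a fin_num.
  by rewrite fin_real// Ent_gtNy//= Ent_fin.
(* One [t] is spent in [discrete_entropy_le]; the other makes the inequality strict, so that it
   survives replacing [B l] by the nearby local masses on [X_i]. *)
have ent_le j : \sum_l C j l * ln (C j l / B l) < fine (Ent m (mus j)) + 2 * t.
  have := discrete_entropy_le Xm Xc Xb PU mfin t0 (Ent_fin j).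
  by rewrite -(fineK (Entfin j)) -EFinD lee_fin -/(C j _); move: t0; rewrite /C /B; lra.
have ent_cvg j : \sum_l C j l * ln (C j l / local_mass (ms i) (@phis i) h l) @[i --> \oo] -->
    \sum_l C j l * ln (C j l / B l).
  (* Terms with [C j l = 0] vanish for every [i]; in the others [B l > 0], so [ln] is continuous at
     the limit ratio. *)
  apply: cvg_sumR => l; have [->|Cjl] := eqVneq (C j l) 0.
    by under eq_fun do rewrite mul0r; rewrite mul0r; exact: cvg_cst.
  have Cp : 0 < C j l by rewrite lt_neqAle eq_sym Cjl C0.
  have Bp : 0 < B l by exact: (CB j).
  apply: cvgMr; apply: continuous_cvg.
    by apply: continuous_ln; exact: divr_gt0.
  by apply: cvgMr; apply: cvgV => //; rewrite gt_eqF.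
have : \forall i \near \oo, [/\ (k <= i)%N, eps i <= t,
    forall j l, 0 < C j l -> 0 < local_mass (ms i) (@phis i) h l &
    forall j, \sum_l C j l * ln (C j l / local_mass (ms i) (@phis i) h l) <=
      fine (Ent m (mus j)) + 2 * t].
  near=> i; split.
  - by near: i; exact: nbhs_infty_ge.
  - by near: i; exact: (cvgr_le _ eps_cvg).
  - near: i; apply: filter_forall => j; apply: filter_forall => l.
    have [Bl|Bl] := ltP 0 (B l); last first.
      near=> i => Cjl; have := @CB j l; rewrite (gt_eqF Cjl) => /(_ isT).
      by rewrite ltNge Bl.
    have /cvgr_gt/(_ _ Bl) := Bcvg l; by apply: filterS.
  - near: i; apply: filter_forall => j.
    exact: (cvgr_le _ (ent_cvg j) _ (ent_le j)).
move=> /filter_ex[i [ki epsi mass_i ent_i]].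
have [nuX [pis [v H]]] := recovery_step X_mms (@Xs_mms i) (@Xs_BCD i) (@mphis i) (@phis_approx i)
  (@eps0 i) dist_le t0 epsi PU wP mass_i ent_i.
by exists i, nuX, pis, v.
Unshelve. all: by end_near. Qed.

End step.

Lemma stability_finite_entropy n (w : 'I_n -> R) (mus : 'I_n -> probability X R) :
  prob_weights w -> (forall j, (Ent m (mus j) < +oo)%E) ->
  exists nu : probability X R, is_barycenter dist w mus nu /\
    (Ent m nu <= \sum_(j < n) (w j)%:E * Ent m (mus j)
                   - (K / 2)%:E * Var dist w mus)%E.
Proof.
move=> wP Ent_fin; have [w0 w1] := wP.
have [D D0 dist_le] := dist_bounded Xm Xc Xb.
pose t k : R := k.+1%:R^-1.
have t0 k : 0 < t k by rewrite invr_gt0.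
have /choice[i /choice[nus /choice[pis /choice[v H]]]] :=
  fun k => stability_step wP dist_le Ent_fin k (t0 k).
have [U [UU sU]] := @ultraFilterLemma _ (\oo : set_system nat) _.
have tU : t k @[k --> U] --> 0.
  by apply: cvg_trans (@cvg_harmonic R); exact: cvg_app sU.
have iU : i @ U --> \oo.
  move=> P [k0 _ k0P]; apply: sU; exists k0 => // k /= k0k; apply: k0P.
  by apply: leq_trans k0k _; case: (H k).
have errU : transfer_error D (t k) @[k --> U] --> 0.
  rewrite (_ : 0 = transfer_error D 0); last by rewrite /transfer_error; ring.
  have c_ (a : R) : a @[_ --> U] --> a by exact: cvg_cst.
  have t6 : 6 * t k @[k --> U] --> 6 * (0 : R) by exact: cvgMr.
  apply: cvgD; first apply: cvgD => //.
    by apply: cvgM => //; apply: cvgD.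
  by apply: cvgM => //; apply: cvgD => //; apply: cvgMr; apply: cvgD.
have Vfin := Var_fin_num Xm Xc Xb mus wP.
have [j F lF|j k F lF|nu [pi [nus_nu piE pid]]] := limit_coupling Xm Xc Xb
    (weights_nonempty wP) (nus := nus) (pis := fun j k => pis k j) UU (mus := mus).
- have [L L0 FL] := lF; apply/cvgrPdist_le => e e0.
  have : L * (3 * t k) @[k --> U] --> L * (3 * 0) by do 2 apply: cvgMr.
  rewrite !mulr0 => /cvgr_le/(_ _ e0); apply: filterS => k; apply: le_trans.
  by rewrite distrC; have [_ [+ _ _ _ _]] := H k; exact.
- by have [_ [_ + _ _ _]] := H k; apply; exact: lipX.
have cvgS : \sum_j w j * \int[pis k j]_z dist z.1 z.2 ^+ 2 @[k --> U] -->
    \sum_j w j * \int[pi j]_z dist z.1 z.2 ^+ 2.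
  by apply: cvg_sumR => j; apply: cvgMr; exact: pid.
set S := \sum_j w j * \int[pi j]_z dist z.1 z.2 ^+ 2 in cvgS.
set V := fine (Var dist w mus).
have vle k : v k <= V + transfer_error D (t k) by have [_ []] := H k.
(* [v k] is caught between the plan costs, which tend to [S], and [V], up to errors tending to 0.
   Once [S = V] is known, [v k] converges, which handles both signs of [K]. *)
have lev k : \sum_j w j * \int[pis k j]_z dist z.1 z.2 ^+ 2 - transfer_error D (t k) <= v k.
  by rewrite lerBlDr; have [_ []] := H k.
have cV : V + transfer_error D (t k) @[k --> U] --> V.
  by rewrite -[X in _ --> X]addr0; apply: cvgD => //; exact: cvg_cst.
have cS : \sum_j w j * \int[pis k j]_z dist z.1 z.2 ^+ 2 - transfer_error D (t k)
    @[k --> U] --> S.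
  by rewrite -[X in _ --> X]subr0; exact: cvgB.
have SV : S <= V.
  by apply: ler_cvg_to cS cV _; apply: nearW => k; exact: le_trans (lev k) (vle k).
have [nu_bar SE] : is_barycenter dist w mus nu /\ S%:E = Var dist w mus.
  by apply: barycenter_of_limit => //; rewrite -(fineK Vfin) lee_fin.
have {}SE : S = V by rewrite /V -SE.
have vU : v k @[k --> U] --> V.
  apply: (squeeze_cvgr _ _ cV); last by rewrite SE in cS; exact: cS.
  by apply: nearW => k; rewrite lev vle.
exists nu; split=> //.
have Entfin j : Ent m (mus j) \is a fin_num.
  by rewrite fin_real// Ent_gtNy//= Ent_fin.
have -> : (\sum_(j < n) (w j)%:E * Ent m (mus j) - (K / 2)%:E * Var dist w mus)%E =
    (\sum_j w j * fine (Ent m (mus j)) - K / 2 * V)%:E.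
  have -> : Var dist w mus = V%:E by rewrite /V fineK.
  rewrite EFinB EFinM -sumEFin; congr (_ - _)%E.
  by apply: eq_bigr => j _; rewrite EFinM fineK.
apply: (Ent_le_dual Xm Xc Xb mfin) => f lf.
have bf := lipX lf; have [_ [M fM]] := bf.
have lexp : lipschitz_dist dist (fun x => expR (f x - 1)).
  apply: (@lipschitz_expR _ _ _ _ (M + 1)).
    by apply: lipschitzB => //; exact: lipschitz_cst.
  by move=> x; rewrite (le_trans (ler_normB _ _))// normr1 lerD2r.
have cL : \int[nus k]_x f x - \int[ms (i k)]_y expR (f (@phis (i k) y) - 1) @[k --> U] -->
    \int[nu]_x f x - \int[m]_x expR (f x - 1).
  apply: cvgB; first exact: nus_nu.
  exact: (cvg_comp _ _ iU (lipschitz_integral_cvg lexp)).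
have cR : \sum_j w j * (fine (Ent m (mus j)) + 2 * t k) - K / 2 * v k @[k --> U] -->
    \sum_j w j * (fine (Ent m (mus j)) + 2 * 0) - K / 2 * V.
  apply: cvgB; last exact: cvgMr.
  apply: cvg_sumR => j; apply: cvgMr; apply: cvgD; first exact: cvg_cst.
  exact: cvgMr.
under [X in _ <= X - _]eq_bigr => j _ do rewrite -[fine _]addr0 -[X in _ + X](mulr0 2).
apply: ler_cvg_to cL cR _; apply: nearW => k.
by have [_ [_ _ _ _ +]] := H k; exact.
Qed.

Lemma stability : BCD dist m K.
Proof.
move=> n w mus wP _; have [w0 w1] := wP.
have [fin|] := pselect (forall j, 0 < w j -> (Ent m (mus j) < +oo)%E); last first.
  move=> /existsNP[j /not_implyP[wj /negP]]; rewrite -leNgt leye_eq => /eqP Entj.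
  have [nu nu_bar] := barycenter_exists Xm Xc Xb mus wP.
  exists nu; split=> //.
  rewrite -(fineK (Var_fin_num Xm Xc Xb mus wP)) -EFinM.
  rewrite (bigD1 j)//= Entj gt0_muley ?lte_fin// addye ?addye ?leey//.
  (* With one entropy equal to +oo, the right-hand side is +oo as soon as no other term is -oo. *)
  rewrite esum_eqNy; apply/negP => /existsP[l /andP[_ /eqP wl]].
  have := Ent_gtNy (mus l) mfin; move: (w0 l); rewrite le_eqVlt => /predU1P[wl0|wl0].
    by move: wl; rewrite -wl0 mul0e.
  move: wl; case: (Ent m (mus l)) => [r| |]//.
  by rewrite gt0_muley// lte_fin.
have [j0 wj0] : exists j, 0 < w j.
  apply: contrapT => /forallNP w_le; have := w1; rewrite big1 => [/esym/eqP|j _].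
    by rewrite oner_eq0.
  by apply/eqP; rewrite eq_le w0 leNgt andbT; exact/negP.
(* Indices of weight zero may carry infinite entropy; they do not affect the claim. *)
pose mus' j := if 0 < w j then mus j else mus j0.
have mus'_fin j : (Ent m (mus' j) < +oo)%E by rewrite /mus'; case: ifPn => wj; exact: fin.
have w_mus' (F : probability X R -> \bar R) j : ((w j)%:E * F (mus' j) = (w j)%:E * F (mus j))%E.
  rewrite /mus'; case: ltP => // wj.
  have -> : w j = 0 by apply/eqP; rewrite eq_le w0 wj.
  by rewrite !mul0e.
have wcost' nu : wcost dist w mus' nu = wcost dist w mus nu.
  by apply: eq_bigr => j _; rewrite (w_mus' (fun mu => W2sq dist mu nu)).
have Var' : Var dist w mus' = Var dist w mus.
  by rewrite /Var; congr ereal_inf; apply: eq_imagel => nu _; exact: wcost'.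
have [nu [nu_bar nu_Ent]] := stability_finite_entropy wP mus'_fin.
exists nu; split; first by rewrite /is_barycenter -wcost' -Var'.
rewrite -Var'; apply: le_trans nu_Ent _; apply: leeB => //.
by apply: lee_sum => j _; rewrite (w_mus' (Ent m)).
Qed.

End stability.

Theorem theorem6p6 (R : realType) (K : R)
    (dXs : nat -> measure_display) (Xs : forall i, measurableType (dXs i))
    (dists : forall i, Xs i -> Xs i -> R)
    (ms : forall i, {measure set Xs i -> \bar R})
    (d : measure_display) (X : measurableType d) (dist : X -> X -> R)
    (m : {measure set X -> \bar R}) :
  (forall i, compact_mms (dists i) (ms i)) ->
  (forall i, BCD (dists i) (ms i) K) ->
  compact_mms dist m ->
  mGH_converges dists ms dist m ->
  BCD dist m K.
Proof.
move=> Xs_mms Xs_BCD X_mms [eps [phis [[eps0 _] eps_cvg approx mphis cvg_ms]]].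
by have := stability Xs_mms Xs_BCD X_mms eps0 eps_cvg approx mphis cvg_ms.
Qed.
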